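(* (i) The space $\mathcal{N}^{\#}_{\mathcal{X}}$ is a complete separable metric space when it is equipped with the distance function $d^{\#}$. (ii) The corresponding Borel $\sigma$-algebra $\mathcal{B}(\mathcal{N}^{\#}_{\mathcal{X}})$ is the smallest $\sigma$-algebra on $\mathcal{N}^{\#}_{\mathcal{X}}$ that makes all mappings $\Phi_A:\mathcal{N}^{\#}_{\mathcal{X}}\to\mathbb{N}\cup\{\infty\}$, $A\in\mathcal{B}(\mathcal{X})$, measurable, where $\Phi_A(\xi)=\xi(A)$.
   Context: $\mathcal{X}$ is a complete separable metric space with Borel $\sigma$-algebra $\mathcal{B}(\mathcal{X})$ and a fixed origin $x_0\in\mathcal{X}$. $B_r(x)$ is the open ball of radius $r\ge 0$ centred at $x$, and $B_r:=B_r(x_0)$. For $A\subset\mathcal{X}$ and $\varepsilon\ge 0$, $A^{\varepsilon}:=\bigcup_{a\in A}B_{\varepsilon}(a)$. A Borel measure $\xi$ on $\mathcal{X}$ is totally finite if $\xi(\mathcal{X})<\infty$, and boundedly finite if $\xi(A)<\infty$ for every bounded Borel set $A$. $\mathcal{M}_{\mathcal{X}}$ is the space of totally finite Borel measures, and $\mathcal{N}^{\#}_{\mathcal{X}}$ is the space of boundedly finite Borel measures on $\mathcal{X}$ taking values in $\mathbb{N}\cup\{\infty\}$ (nonnegative integers, including $0$, or $\infty$). For a Borel measure $\xi$ and $r\ge 0$, $\xi^{(r)}$ is the restriction $\xi^{(r)}(A):=\xi(A\cap B_r)$, $A\in\mathcal{B}(\mathcal{X})$. The Prohorov distance on $\mathcal{M}_{\mathcal{X}}$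 is $$d(\mu,\nu):=\inf\{\varepsilon\ge 0:\ \mu(A)\le\nu(A^{\varepsilon})+\varepsilon\ \text{and}\ \nu(A)\le\mu(A^{\varepsilon})+\varepsilon\ \text{for all closed } A\subset\mathcal{X}\}.$$ The $w^{\#}$-distance on $\mathcal{N}^{\#}_{\mathcal{X}}$ is $$d^{\#}(\mu,\nu):=\int_0^{\infty}e^{-r}\frac{d(\mu^{(r)},\nu^{(r)})}{1+d(\mu^{(r)},\nu^{(r)})}\,dr.$$ $\mathcal{B}(\mathcal{N}^{\#}_{\mathcal{X}})$ is the Borel $\sigma$-algebra of the topology induced by $d^{\#}$; $\mathbb{N}\cup\{\infty\}$ carries the $\sigma$-algebra of all its subsets. *)

(* Defs.v *)
From HB Require Import structures.
From mathcomp Require Import all_boot all_order all_algebra.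
From mathcomp Require Import all_classical all_reals all_analysis.

Set Implicit Arguments.
Unset Strict Implicit.
Unset Printing Implicit Defensive.
Import Order.TTheory GRing.Theory Num.Theory.
Import numFieldNormedType.Exports.
Local Open Scope classical_set_scope.
Local Open Scope ring_scope.

#[short(type="completeMetricType")]
HB.structure Definition CompleteMetric (R : numDomainType) :=
  {T of Metric R T & Complete T}.

Definition separable (T : topologicalType) : Prop :=
  exists2 D : set T, countable D & dense D.

(* [cauchy_cvg] of [completeType], without requiring a pointed type. *)
Definition complete_space (T : uniformType) : Prop :=
  forall F : set_system T, ProperFilter F -> cauchy F -> exists l : T, F --> l.

Record is_metric (R : realType) (T : Type) (d : T -> T -> R) : Prop := IsMetric {
  is_metric_xx : forall x, d x x = 0;
  is_metric_eq : forall x y, d x y = 0 -> x = y;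
  is_metric_sym : forall x y, d x y = d y x;
  is_metric_tri : forall y x z, d x z <= d x y + d y z }.

(* [T] as a [metricType] with distance [d]: this carries the topology and the
   uniform structure induced by [d]. *)
Definition metric_space (R : realType) (T : Type) (d : T -> T -> R)
  (Hd : is_metric d) : Type := T.

Section metric_space_instance.
Context (R : realType) (T : Type) (d : T -> T -> R) (Hd : is_metric d).

HB.instance Definition _ := gen_eqMixin (metric_space Hd).
HB.instance Definition _ := gen_choiceMixin (metric_space Hd).
HB.instance Definition _ := @isMetric.Build R (metric_space Hd) d
  (is_metric_xx Hd) (is_metric_eq Hd) (is_metric_sym Hd) (is_metric_tri Hd).

End metric_space_instance.

Notation borelType X := (g_sigma_algebraType (@open X)).

Section boundedly_finite_measures.
Context (R : realType) (X : completeMetricType R).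
Implicit Types (A : set X) (x : X) (r e : R).

Definition mbounded A : Prop := exists x r, A `<=` ball x r.

Definition ext_nat : set (\bar R) :=
  [set y | y = +oo%E \/ exists n : nat, y = n%:R%:E].

(* A library measure is a total function on [set X], so it also has (meaningless)
   values on non-Borel sets. These are fixed to be 0, so that two elements of
   [Nsharp] are equal if and only if they agree on all Borel sets. *)
Record Nsharp := MkNsharp {
  Nsharp_measure :> {measure set (borelType X) -> \bar R};
  Nsharp_bounded : forall A : set (borelType X),
    measurable A -> mbounded A -> (Nsharp_measure A < +oo)%E;
  Nsharp_nat : forall A : set (borelType X),
    measurable A -> ext_nat (Nsharp_measure A);
  Nsharp_junk : forall A : set (borelType X),
    ~ measurable A -> Nsharp_measure A = 0%E }.

Definition enlarge A e : set X := \bigcup_(a in A) ball a e.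

Definition prohorov (mu nu : {finite_measure set (borelType X) -> \bar R}) : R :=
  inf [set e | 0 <= e /\ forall A, closed A ->
    (mu A <= nu (enlarge A e) + e%:E)%E /\ (nu A <= mu (enlarge A e) + e%:E)%E].

Lemma measurable_ball_borel x r : measurable (ball x r : set (borelType X)).
Proof.
apply: sub_sigma_algebra; rewrite openE => y.
rewrite ballEmdist /= => xy; rewrite /interior -nbhs_ballE.
exists (r - mdist x y); first by rewrite /= subr_gt0.
move=> z; rewrite !ballEmdist /= ltrBrDl; apply: le_lt_trans.
exact: metric_triangle.
Qed.

Lemma Nsharp_ball_lty (xi : Nsharp) x r : (xi (ball x r) < +oo)%E.
Proof.
by apply: Nsharp_bounded; [exact: measurable_ball_borel|exists x, r].
Qed.

Definition restr_ball (x0 : X) (xi : Nsharp) r :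
    {finite_measure set (borelType X) -> \bar R} :=
  mfrestr (measurable_ball_borel x0 r) (Nsharp_ball_lty xi x0 r).

Definition dsharp (x0 : X) (mu nu : Nsharp) : R :=
  \int[lebesgue_measure]_(r in `[0, +oo[)
    (expR (- r) * (prohorov (restr_ball x0 mu r) (restr_ball x0 nu r) /
                   (1 + prohorov (restr_ball x0 mu r) (restr_ball x0 nu r)))).

Definition Phi (A : set (borelType X)) (xi : Nsharp) : \bar R := xi A.

(* [ext_nat], the codomain of [Phi A], carries the sigma-algebra of all its
   subsets. *)
Definition makes_Phi_measurable (F : set_system Nsharp) : Prop :=
  forall A : set (borelType X), measurable A ->
  forall S : set (\bar R), S `<=` ext_nat -> F (Phi A @^-1` S).

End boundedly_finite_measures.

Arguments Nsharp {R} X.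

(* Main.v *)
Require Import Defs.
From HB Require Import structures.
From mathcomp Require Import all_boot all_order all_algebra.
From mathcomp Require Import all_classical all_reals all_analysis measurable_realfun.
From mathcomp Require Import zify ring lra.
Import Order.TTheory GRing.Theory Num.Theory.
Import numFieldNormedType.Exports.
Local Open Scope classical_set_scope.
Local Open Scope ring_scope.
Set Implicit Arguments.
Unset Strict Implicit.
Unset Printing Implicit Defensive.

(** Inside a ball of finite radius an integer-valued measure is the counting measure
    of a finite list of points: a set of positive mass can be shrunk to a single
    point without its mass dropping below 1 ([ex_atom], [finite_atoms]). Write
    [pts xi r] for the list of the atoms of [xi] at distance less than [r] from [x0],
    and [hits s A] for the number of entries of [s] in [A]. By integrality, if
    the Prohorov distance between the restrictions of [xi] and [zeta] to the ball of
    radius [r] is smaller than [q <= 1], then [hits (pts xi r) A] never exceeds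
    [hits (pts zeta r) (enlarge A q)], and the same holds with [xi] and [zeta]
    exchanged ([prohorov_hits]). All arguments rest on such inequalities.

    The distance. The restriction of [xi] to a ball changes with the radius only
    when the mass of the ball does, so the integrand is a step function up to the
    exponential factor and is measurable ([measurable_distr]); symmetry and the
    triangle inequality are then inherited from the Prohorov distance. When
    [dsharp x0 xi zeta] is small, each unit interval of radii contains one at which
    the restrictions are Prohorov-close ([dsharp_close]). It follows that
    [xi |-> xi G] is lower semicontinuous for [G] open ([dsharp_lsc]), and that
    measures at distance 0 are equal.

    In the other direction, closeness in one large ball implies closeness in every
    smaller ball whose sphere stays away from the points concerned
    ([distr_le_restrict]). The spheres that carry atoms of a given measure are
    countably many, so dominated convergence gives convergence for [dsharp]. This
    step is used twice.

    First, for separability and for the minimality of the Borel sigma-algebra. There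
    is a countable family of sets, [box e c n], each defined by finitely many
    conditions on masses of Borel sets, such that every measure lies in boxes of
    arbitrarily small radius for [dsharp] ([box_basis]). Choosing a point in each
    nonempty box gives a dense sequence, and writing open sets as unions of boxes
    puts them in each sigma-algebra that makes the maps [Phi A] measurable. That the
    Borel sigma-algebra is one of these follows from lower semicontinuity for open
    [A], then from Dynkin's induction.

    Second, for completeness. Along a sequence whose successive distances decrease
    fast, Borel-Cantelli provides arbitrarily large radii at which the successive
    Prohorov distances are eventually below [2 ^- n] ([fast_radius]). By Hall's
    marriage theorem the inequalities between counts yield bijections between
    successive lists that move each point by less than [2 ^- n], so the points run
    along Cauchy sequences and converge to the points of a limit list
    ([limit_configuration]). The lists found at different radii agree where both
    make sense ([conv_at_le]) and glue into a measure ([glue]), which is the limit. *)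

(** * Integer-valued measures are locally finite lists of points *)

Section integers.
Context (R : realType).
Implicit Types y : \bar R.

Lemma ext_nat_ge1 y : ext_nat y -> (0 < y)%E -> (1 <= y)%E.
Proof.
move=> [->//|[n ->]]; first by rewrite leey.
by rewrite lte_fin lee_fin ltr0n ler1n.
Qed.

Lemma ext_nat_fin y : ext_nat y -> (y < +oo)%E -> exists n : nat, y = n%:R%:E.
Proof. by move=> [->|//]. Qed.

Lemma ext_nat_gt (m : nat) y : ext_nat y -> (m%:R%:E < y)%E -> (m.+1%:R%:E <= y)%E.
Proof.
move=> [->|[n ->]]; first by rewrite leey.
by rewrite lte_fin lee_fin ltr_nat ler_nat.
Qed.

End integers.

Section half_powers.
Context (R : realType).
Implicit Types n : nat.

Lemma half_gt0 n : 0 < 2 ^- n :> R.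
Proof. by rewrite invr_gt0 exprn_gt0. Qed.

Lemma half_le1 n : 2 ^- n <= 1 :> R.
Proof. by rewrite invf_le1 ?exprn_gt0// exprn_ege1// ler1n. Qed.

Lemma halfS n : 2 ^- n.+1 = 2 ^- n / 2 :> R.
Proof. by rewrite exprS invfM mulrC. Qed.

End half_powers.

Section hits.
Context (T : eqType).
Implicit Types (s : seq T) (A B : set T).

Definition hits s A : nat := count (fun x => x \in A) s.

Lemma hits_le s A B : (forall x, x \in s -> A x -> B x) -> (hits s A <= hits s B)%N.
Proof.
elim: s => //= x s IH sAB; rewrite /hits /= leq_add//.
  case: (boolP (x \in A)) => //; rewrite inE => Ax.
  by rewrite mem_set//; apply: sAB => //; rewrite mem_head.
by apply: IH => y ys; apply: sAB; rewrite inE ys orbT.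
Qed.

Lemma hits_eq s A B : (forall x, x \in s -> A x <-> B x) -> hits s A = hits s B.
Proof.
by move=> AB; apply/eqP; rewrite eqn_leq !hits_le// => x /AB[].
Qed.

Lemma hitsT s : hits s setT = size s.
Proof. by rewrite /hits -[RHS](count_predT s); apply: eq_count => x;
  rewrite in_setT. Qed.

Lemma hits_leT s A : (hits s A <= size s)%N.
Proof. exact: count_size. Qed.

Lemma hits_eqT s A : hits s A = size s -> forall x, x \in s -> A x.
Proof. by move/eqP; rewrite -all_count => /allP sA x /sA; rewrite inE. Qed.

Lemma hitsC s A : (hits s A + hits s (~` A))%N = size s.
Proof.
rewrite -(count_predC (fun x => x \in A) s); congr addn.
by apply: eq_count => x /=; rewrite in_setC.
Qed.

Lemma hits0 s : hits s set0 = 0%N.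
Proof. by rewrite /hits -(count_pred0 s); apply: eq_count => x; rewrite in_set0. Qed.

Lemma hits_setID s A B : hits s A = (hits s (A `&` B) + hits s (A `\` B))%N.
Proof.
elim: s => //= x s; rewrite /hits /= => ->; rewrite in_setI in_setD.
by case: (x \in A) (x \in B) => -[] /=; lia.
Qed.

Lemma hits_filter s A B : hits [seq x <- s | x \in B] A = hits s (A `&` B).
Proof.
by rewrite /hits count_filter; apply: eq_count => x /=; rewrite in_setI.
Qed.

End hits.

Section metric.
Context (R : realType) (X : completeMetricType R).
Implicit Types (A C : set X) (x y : X) (r e : R).

Lemma in_ball x e y : ball x e y <-> mdist x y < e.
Proof. by rewrite ballEmdist. Qed.

Lemma measurable_openX A : open A -> measurable (A : set (borelType X)).
Proof. exact: sub_sigma_algebra. Qed.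

Lemma measurable_closedX A : closed A -> measurable (A : set (borelType X)).
Proof.
by move=> /closed_openC/measurable_openX/measurableC; rewrite setCK.
Qed.

Lemma open_ballX x r : open (ball x r : set X).
Proof.
rewrite openE => y; rewrite ballEmdist /= => xy; rewrite /interior -nbhs_ballE.
exists (r - mdist x y); first by rewrite /= subr_gt0.
move=> z; rewrite !ballEmdist /= ltrBrDl; apply: le_lt_trans.
exact: metric_triangle.
Qed.

Lemma measurable_set1X x : measurable ([set x] : set (borelType X)).
Proof.
apply: measurable_closedX; apply: accessible_closed_set1.
exact: hausdorff_accessible (@metric_hausdorff _ _).
Qed.

Lemma enlarge_open A e : open (enlarge A e).
Proof. by apply: bigcup_open => a _; exact: open_ballX. Qed.

Lemma measurable_enlarge A e : measurable (enlarge A e : set (borelType X)).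
Proof. by apply: measurable_openX; exact: enlarge_open. Qed.

Lemma enlargeP A e y : enlarge A e y <-> exists2 a, A a & mdist a y < e.
Proof.
by split=> [[a Aa /in_ball ?]|[a Aa ay]]; exists a => //; apply/in_ball.
Qed.

Lemma sub_enlarge A e : 0 < e -> A `<=` enlarge A e.
Proof. by move=> e0 a Aa; apply/enlargeP; exists a => //; rewrite mdistxx. Qed.

Lemma enlarge_le A e e' : e <= e' -> enlarge A e `<=` enlarge A e'.
Proof.
by move=> ee' y /enlargeP[a Aa ay]; apply/enlargeP; exists a => //;
  exact: lt_le_trans ee'.
Qed.

Lemma enlarge_enlarge A e e' : enlarge (enlarge A e) e' `<=` enlarge A (e + e').
Proof.
move=> z /enlargeP[y /enlargeP[a Aa ay] yz]; apply/enlargeP; exists a => //.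
by apply: le_lt_trans (metric_triangle _ y _) _; exact: ltrD.
Qed.

(** Thanks to this inclusion an inequality known for closed sets only, as in the
    Prohorov distance, holds for the open set [enlarge A e] as well. *)
Lemma enlarge_closure A e : enlarge (closure A) e `<=` enlarge A e.
Proof.
move=> y /enlargeP[a clAa ay].
have e'0 : 0 < e - mdist a y by rewrite subr_gt0.
have [b [Ab]] := clAa _ (nbhsx_ballx a _ e'0).
move=> /in_ball ab; apply/enlargeP; exists b => //.
apply: le_lt_trans (metric_triangle b a y) _.
by rewrite (metric_sym b a) -ltrBrDr.
Qed.

(** Indexing the dense set by [nat], with repetitions allowed, lets finite lists of
    its points be coded by the countable type [seq nat]. *)
Lemma separable_seq : separable X -> exists e : nat -> X,
  forall x r, 0 < r -> exists k, mdist (e k) x < r.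
Proof.
move=> [D /countable_injP[f finj] Dd].
exists (fun k => xget point [set x | D x /\ f x = k]) => x r r0.
have /(_ _)[|y [/in_ball xy Dy]] := Dd (ball x r) _ (open_ballX _ _).
  by exists x; exact: ballxx.
exists (f y); case: xgetP => [z _ [Dz fzy]|/(_ y)[]//].
have -> : z = y by apply: finj; rewrite ?inE.
by rewrite metric_sym.
Qed.

End metric.

Section atoms.
Context (R : realType) (X : completeMetricType R).
Hypothesis sepX : separable X.
Implicit Types (xi : Nsharp X) (A C E : set (borelType X)).

(** Countably many balls of radius [r] cover the space; if each met [E] in a null
    set, then [E] would be null. *)
Lemma small_positive_part xi E (r : R) : measurable E -> (0 < xi E)%E -> 0 < r ->
  exists x : X, (0 < xi (E `&` ball x r))%E.
Proof.
move=> mE E0 r0; have [d dP] := separable_seq sepX.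
apply: contrapT => /forallNP H.
have H0 k : xi (E `&` ball (d k) r) = 0%E.
  by apply/eqP; rewrite eq_le measure_ge0 andbT leNgt; apply/negP/H.
have mEb k : measurable (E `&` (ball (d k) r : set (borelType X))).
  by apply: measurableI => //; exact: measurable_ball_borel.
have /(measure_sigma_subadditive xi mEb mE) : E `<=` \bigcup_n (E `&` ball (d n) r).
  by move=> x Ex; have [k kx] := dP x r r0; exists k => //; split => //; exact/in_ball.
by rewrite eseries0// leNgt E0.
Qed.

(** Cutting [E] down by balls of radius 1, 1/2, 1/3, ... while keeping positive mass
    gives a decreasing sequence whose masses are all at least 1, by integrality.
    So its intersection has mass at least 1, which makes it nonempty; having
    diameter 0, it is a single point. *)
Lemma ex_atom xi E : measurable E -> (xi E < +oo)%E -> (0 < xi E)%E ->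
  exists2 x : X, E x & (0 < xi [set x])%E.
Proof.
move=> mE Eoo E0.
pose good := {C : set (borelType X) | [/\ measurable C, C `<=` E & (0 < xi C)%E]}.
have step (n : nat) (C : good) : {x : X | (0 < xi (sval C `&` ball x n.+1%:R^-1))%E}.
  by case: C => C [mC CE C0] /=; apply/cid/small_positive_part.
pose next n (C : good) := sval C `&` ball (sval (step n C)) n.+1%:R^-1.
have stepP n (C : good) : [/\ measurable (next n C), next n C `<=` E &
  (0 < xi (next n C))%E].
  rewrite /next; case: (step n C) => x /=; case: C => C [mC CE C0] /= x0.
  split => //; first by apply: measurableI => //; exact: measurable_ball_borel.
  by apply: subset_trans CE => ? [].
pose F := fix F n : good := if n is n'.+1 then exist _ _ (stepP n' (F n')) else
   exist _ E (And3 mE (@subset_refl _ E) E0).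
pose G n := sval (F n).
have mG n : measurable (G n) by rewrite /G; case: (F n) => ? [].
have GE n : G n `<=` E by rewrite /G; case: (F n) => ? [].
have G0 n : (0 < xi (G n))%E by rewrite /G; case: (F n) => ? [].
have Gdec : nonincreasing_seq G.
  apply/nonincreasing_seqP => n; apply/subsetPset; rewrite /G /= => ? [].
  by [].
have mcap : measurable (\bigcap_n G n) by exact: bigcapT_measurable.
have Gcvg := nonincreasing_cvg_mu (Eoo : (xi (G 0%N) < +oo)%E) mG mcap Gdec.
have cap1 : (1 <= xi (\bigcap_n G n))%E.
  rewrite -(cvg_lim _ Gcvg)//; apply: lime_ge; first by apply/cvg_ex; eexists;
    exact: Gcvg.
  by apply: nearW => n /=; apply: ext_nat_ge1 => //; exact: Nsharp_nat.
have [x capx] : \bigcap_n G n !=set0.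
  by apply/set0P; apply/negP => /eqP cap0; move: cap1;
    rewrite cap0 measure0 lee_fin ler10.
exists x; first exact: (GE 0%N _ (capx 0%N I)).
suff <- : \bigcap_n G n = [set x] by rewrite (lt_le_trans _ cap1).
apply/seteqP; split => [y capy|_ ->//] /=.
apply: mdist_positivity; apply/eqP; rewrite eq_le mdist_ge0 andbT.
apply/ler_addgt0Pl => /= e e0; rewrite addr0.
have e20 : 0 < e / 2 by rewrite divr_gt0.
near \oo => n.
have : n.+1%:R^-1 < e / 2.
  by near: n; exact: (near_infty_natSinv_lt (PosNum e20)).
set q := _^-1 => nq.
have [_ /in_ball] := capx n.+1 I; have [_ /in_ball] := capy n.+1 I.
rewrite -/q; set z := sval _ => zy zx.
have := metric_triangle y z x; rewrite (metric_sym y z).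
lra.
Unshelve. all: end_near. Qed.

(** Induction on the mass of [E]: remove one atom, with its full multiplicity, at a
    time. *)
Lemma finite_atoms xi E : measurable E -> (xi E < +oo)%E ->
  exists s : seq X, forall A, measurable A -> xi (A `&` E) = (hits s A)%:R%:E.
Proof.
move=> mE Eoo; have [n] := ext_nat_fin (Nsharp_nat xi mE) Eoo.
elim/ltn_ind: n E mE Eoo => n IH E mE Eoo En.
have [n0|n0] := posnP n.
  exists [::] => A mA; apply/eqP; rewrite eq_le measure_ge0 andbT.
  by move: En; rewrite n0 => <-; apply: measureIr.
have [|x Ex x0] := ex_atom mE Eoo; first by rewrite En lte_fin ltr0n.
have mx := measurable_set1X x.
have xoo : (xi [set x] < +oo)%E.
  by apply: le_lt_trans Eoo; apply: le_measure; rewrite ?inE// => _ ->.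
have [k xk] := ext_nat_fin (Nsharp_nat xi mx) xoo.
have mEx : measurable (E `\ x) by exact: measurableD.
have Ex_oo : (xi (E `\ x) < +oo)%E.
  by apply: le_lt_trans Eoo; apply: le_measure; rewrite ?inE// => ? [].
have [m Exm] := ext_nat_fin (Nsharp_nat xi mEx) Ex_oo.
have split_at A : measurable A ->
  xi (A `&` E) = (xi (A `&` (E `\ x)) + xi (A `&` [set x]))%E.
  move=> mA; rewrite (measureDI xi (measurableI _ _ mA mE) mx) /= -setIDA;
    congr (_ + xi _)%E.
  by rewrite -setIA; congr setI; apply/seteqP; split => [? []|? ->].
have nmk : n = (m + k)%N.
  have := split_at _ (@measurableT _ (borelType X));
    rewrite !setTI En xk Exm -EFinD => -[].
  by rewrite -natrD => /eqP; rewrite eqr_nat => /eqP.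
have k0 : (0 < k)%N by move: x0; rewrite xk lte_fin ltr0n.
have [|s sP] := IH m _ _ mEx Ex_oo Exm; first by rewrite nmk -[ltnLHS]addn0 ltn_add2l.
exists (nseq k x ++ s) => A mA; rewrite split_at// sP// /hits count_cat count_nseq.
rewrite addnC natrD EFinD; congr (_ + _)%E.
have [|] := boolP (x \in A); rewrite ?notin_setE ?inE => Ax; last first.
  by rewrite (_ : _ `&` _ = set0) ?measure0//; apply/seteqP; split => // y [Ay yx];
    apply: Ax; rewrite -yx.
by rewrite mul1n setIidr// => _ ->.
Qed.

End atoms.

(** * The Prohorov distance and finite configurations *)

Section prohorov.
Context (R : realType) (X : completeMetricType R).
Implicit Types (mu nu rho : {finite_measure set (borelType X) -> \bar R}).
Implicit Types (A C : set X) (x y : X) (r e : R).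

Definition prohorov_set mu nu := [set e : R | 0 <= e /\ forall A, closed A ->
    (mu A <= nu (enlarge A e) + e%:E)%E /\ (nu A <= mu (enlarge A e) + e%:E)%E].

Lemma prohorov_has_inf mu nu : has_inf (prohorov_set mu nu).
Proof.
split; last by exists 0 => e [].
have fin (rho : {finite_measure set (borelType X) -> \bar R}) : rho setT \is a fin_num.
  exact: fin_num_measure.
have ge0 (rho : {finite_measure set (borelType X) -> \bar R}) : 0 <= fine (rho setT).
  exact: fine_ge0.
exists (fine (mu setT) + fine (nu setT)); split; first exact: addr_ge0.
have bound (rho rho' : {finite_measure set (borelType X) -> \bar R}) A e :
    measurable (A : set (borelType X)) -> fine (rho setT) <= e ->
      (rho A <= rho' (enlarge A e) + e%:E)%E.
  move=> mA rhoe; rewrite -[leLHS]add0e leeD//.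
  rewrite (@le_trans _ _ (rho setT))//; first by apply: le_measure; rewrite ?inE.
  by rewrite -[leLHS]fineK// lee_fin.
move=> A /measurable_closedX mA; split; apply: bound => //.
  by rewrite lerDl.
by rewrite lerDr.
Qed.

Lemma prohorov_ge0 mu nu : 0 <= prohorov mu nu.
Proof.
by apply: lb_le_inf => [|e []//]; exact: (prohorov_has_inf mu nu).1.
Qed.

Lemma prohorov_le mu nu e : prohorov_set mu nu e -> prohorov mu nu <= e.
Proof. by move=> ?; apply: ge_inf => //; exact: (prohorov_has_inf mu nu).2. Qed.

Lemma prohorov_lt mu nu e : prohorov mu nu < e -> prohorov_set mu nu e.
Proof.
move=> /(inf_lt (prohorov_has_inf mu nu).1)[e' [e'0 e'P] e'e].
have le_step rho A : measurable (A : set (borelType X)) ->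
    (rho (enlarge A e') + e'%:E <= rho (enlarge A e) + e%:E)%E.
  move=> mA; apply: leeD; last by rewrite lee_fin ltW.
  apply: le_measure; rewrite ?inE; [exact: measurable_enlarge..|].
  exact/enlarge_le/ltW.
split; first exact: le_trans (ltW e'e).
move=> A cA; have mA := measurable_closedX cA; have [h1 h2] := e'P A cA.
by split; [apply: le_trans h1 _|apply: le_trans h2 _]; exact: le_step.
Qed.

Lemma prohorov_sym mu nu : prohorov mu nu = prohorov nu mu.
Proof.
by congr inf; apply/seteqP; split => e [e0 eP]; split => // A /eP[].
Qed.

Lemma prohorovxx mu : prohorov mu mu = 0.
Proof.
apply/eqP; rewrite eq_le prohorov_ge0 andbT; apply/ler_addgt0Pl => e e0.
rewrite addr0; apply: prohorov_le; split=> [|A cA]; first exact: ltW.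
suff H : (mu A <= mu (enlarge A e) + e%:E)%E by [].
rewrite -[leLHS]adde0 leeD ?lee_fin ?(ltW e0)//.
apply: le_measure; rewrite ?inE; first exact: measurable_closedX.
  exact: measurable_enlarge.
exact: sub_enlarge.
Qed.

(** If [e1] and [e2] are admissible for the two pairs, apply the second condition to
    the closure of [enlarge A e1]; [enlarge_closure] and [enlarge_enlarge] bring
    the result back inside [enlarge A (e1 + e2)]. *)
Lemma prohorov_triangle mu nu rho :
  prohorov mu rho <= prohorov mu nu + prohorov nu rho.
Proof.
apply/ler_addgt0Pr => e e0; have e20 : 0 < e / 2 by rewrite divr_gt0.
have chain (m1 m2 m3 : {finite_measure set (borelType X) -> \bar R}) e1 e2 A :
    prohorov_set m1 m2 e1 -> prohorov_set m2 m3 e2 -> closed A ->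
    (m1 A <= m3 (enlarge A (e1 + e2)) + (e1 + e2)%:E)%E.
  move=> [_ P1] [_ P2] cA; apply: le_trans (P1 A cA).1 _.
  rewrite EFinD (addeC e1%:E) addeA leeD2r//.
  have cl := @closed_closure _ (enlarge A e1).
  apply: le_trans (le_trans _ (P2 _ cl).1) _.
    apply: le_measure; rewrite ?inE; first exact: measurable_enlarge.
      exact: measurable_closedX.
    exact: subset_closure.
  rewrite leeD2r//; apply: le_measure; rewrite ?inE; [exact: measurable_enlarge..|].
  by apply: subset_trans (@enlarge_closure _ _ _ _) _; exact: enlarge_enlarge.
have P1 : prohorov mu nu < prohorov mu nu + e / 2 by rewrite ltrDl.
have P2 : prohorov nu rho < prohorov nu rho + e / 2 by rewrite ltrDl.
have P3 : prohorov rho nu < prohorov nu rho + e / 2 by rewrite prohorov_sym ltrDl.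
have P4 : prohorov nu mu < prohorov mu nu + e / 2 by rewrite prohorov_sym ltrDl.
rewrite [e in leRHS]splitr addrACA; apply: prohorov_le; split.
  by rewrite !addr_ge0// ?prohorov_ge0// ltW.
move=> A cA; split; first exact: chain (prohorov_lt P1) (prohorov_lt P2) cA.
by rewrite [X in enlarge _ X]addrC [X in X%:E]addrC;
  exact: chain (prohorov_lt P3) (prohorov_lt P4) cA.
Qed.

End prohorov.

Section configurations.
Context (R : realType) (X : completeMetricType R) (x0 : X).
Hypothesis sepX : separable X.
Implicit Types (xi zeta : Nsharp X) (A C : set (borelType X)).

Local Notation B r := (ball x0 r : set (borelType X)).

(** The atoms of [xi] in the ball of radius [r], listed with multiplicity. Their
    order is arbitrary: only the counts [hits (pts xi r) A] are ever used. *)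
Definition pts xi r : seq X := xget [::]
  [set s | forall A, measurable A -> xi (A `&` B r) = (hits s A)%:R%:E].

Lemma ptsP xi r A : measurable A -> xi (A `&` B r) = (hits (pts xi r) A)%:R%:E.
Proof.
rewrite /pts; case: xgetP => [s _ sP|H]; first exact: sP.
have [s sP] := finite_atoms sepX (measurable_ball_borel x0 r) (Nsharp_ball_lty xi x0 r).
by have := H s.
Qed.

Lemma restr_ballE xi r A : restr_ball x0 xi r A = xi (A `&` B r).
Proof. by []. Qed.

Lemma pts_size xi r : xi (B r) = (size (pts xi r))%:R%:E.
Proof.
by rewrite -hitsT -(ptsP _ _ (@measurableT _ (borelType X))) setTI.
Qed.

Lemma pts_ball xi r x : x \in pts xi r -> mdist x0 x < r.
Proof.
have : hits (pts xi r) (B r) = size (pts xi r).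
  apply/eqP; rewrite -(eqr_nat R) -eqe -(ptsP _ _ (measurable_ball_borel _ _)).
  by rewrite setIid pts_size.
by move=> /hits_eqT H /H /in_ball.
Qed.

Lemma ballI_le r r' : r <= r' -> B r' `&` B r = B r.
Proof. by move=> rr'; apply: setIidr; exact: le_ball. Qed.

Lemma pts_le xi r r' A : r <= r' -> measurable A ->
  hits (pts xi r) A = hits (pts xi r') (A `&` B r).
Proof.
move=> rr' mA; have mB := measurable_ball_borel x0 r.
apply/eqP; rewrite -(eqr_nat R) -eqe -!ptsP//; last exact: measurableI.
by rewrite -setIA (setIC (B r)) ballI_le.
Qed.

(** Both sides are integers, so an additive error smaller than 1 disappears. This
    is how Prohorov closeness becomes the hypothesis of the marriage theorem. *)
Lemma prohorov_hits xi zeta r q A : q <= 1 ->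
  prohorov (restr_ball x0 xi r) (restr_ball x0 zeta r) < q ->
  (hits (pts xi r) A <= hits (pts zeta r) (enlarge A q))%N.
Proof.
move=> q1 /(inf_lt (prohorov_has_inf _ _).1)[e [e0 eP] eq].
have [+ _] := eP (closure A) (@closed_closure _ _).
rewrite !restr_ballE !ptsP; [|exact: measurable_enlarge|apply: measurable_closedX;
  exact: closed_closure].
rewrite -EFinD lee_fin => h.
apply: (@leq_trans (hits (pts xi r) (closure A))); first by apply: hits_le => x _;
  exact: subset_closure.
apply: (@leq_trans (hits (pts zeta r) (enlarge (closure A) e))); last first.
  by apply: hits_le => x _ /enlarge_closure; apply: enlarge_le; exact: ltW.
rewrite -ltnS -(ltr_nat R) (le_lt_trans h)// -natr1 ltrD2l.
exact: lt_le_trans q1.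
Qed.

Lemma prohorov_le_hits xi zeta r q : 0 <= q ->
  (forall A, closed A -> (hits (pts xi r) A <= hits (pts zeta r) (enlarge A q))%N) ->
  (forall A, closed A -> (hits (pts zeta r) A <= hits (pts xi r) (enlarge A q))%N) ->
  prohorov (restr_ball x0 xi r) (restr_ball x0 zeta r) <= q.
Proof.
move=> q0 h1 h2; apply: prohorov_le; split => // A cA.
have mA := measurable_closedX cA; have mAq := measurable_enlarge A q.
by rewrite !restr_ballE !ptsP// -!EFinD !lee_fin; split;
  rewrite -[leLHS]addr0 lerD// ler_nat;
  [exact: h1|exact: h2].
Qed.

End configurations.
Arguments ptsP {R X x0} sepX xi r [A].
Arguments pts_le {R X x0} sepX xi [r r' A].

(** * The distance as an integral over the radius *)

Section saturation.
Context (R : realFieldType).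
Implicit Types p q : R.

Definition saturate p := p / (1 + p).

Lemma saturate_ge0 p : 0 <= p -> 0 <= saturate p.
Proof. by move=> p0; rewrite divr_ge0// addr_ge0. Qed.

Lemma saturate_le1 p : 0 <= p -> saturate p <= 1.
Proof. by move=> p0; rewrite ler_pdivrMr ?mul1r ?lerDr// ltr_pwDl. Qed.

Lemma saturate_le_id p : 0 <= p -> saturate p <= p.
Proof. by move=> p0; rewrite ler_pdivrMr ?ltr_pwDl// ler_peMr// lerDl. Qed.

Lemma saturate_gt0 p : 0 < p -> 0 < saturate p.
Proof. by move=> p0; rewrite divr_gt0// addr_gt0. Qed.

Lemma saturate_homo p q : 0 <= p -> p <= q -> saturate p <= saturate q.
Proof.
move=> p0 pq; have q0 := le_trans p0 pq.
by rewrite ler_pdivrMr ?ltr_pwDl// mulrAC ler_pdivlMr ?ltr_pwDl//; nra.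
Qed.

Lemma saturateD p q : 0 <= p -> 0 <= q -> saturate (p + q) <= saturate p + saturate q.
Proof.
move=> p0 q0; rewrite /saturate mulrDl lerD// ler_wpM2l//
  lef_pV2 ?posrE ?ltr_pwDl ?addr_ge0//.
  by rewrite addrA lerDl.
by rewrite addrCA lerDr.
Qed.

End saturation.

Section dsharp.
Context (R : realType) (X : completeMetricType R) (x0 : X).
Hypothesis sepX : separable X.
Implicit Types (xi zeta : Nsharp X) (A C : set (borelType X)).

Local Notation B r := (ball x0 r : set (borelType X)).
Local Notation leb := (@lebesgue_measure R).
Local Notation halfline := (`[0%R, +oo[%classic : set (measurableTypeR R)).

Definition distr xi zeta (r : R) : R :=
  prohorov (restr_ball x0 xi r) (restr_ball x0 zeta r).

Definition weight xi zeta (r : R) : R := expR (- r) * saturate (distr xi zeta r).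

Lemma dsharpE xi zeta : dsharp x0 xi zeta = \int[leb]_(r in halfline) weight xi zeta r.
Proof. by []. Qed.

Lemma prohorov_eq (mu mu' nu nu' : {finite_measure set (borelType X) -> \bar R}) :
  (forall A, measurable A -> mu A = mu' A) -> (forall A, measurable A ->
    nu A = nu' A) ->
  prohorov mu nu = prohorov mu' nu'.
Proof.
move=> muE nuE; congr inf; apply/seteqP; split => e [e0 eP]; split => // A cA.
  rewrite -!muE -?nuE; [exact: eP|..];
    exact: measurable_closedX || exact: measurable_enlarge.
rewrite !muE ?nuE; [exact: eP|..];
  exact: measurable_closedX || exact: measurable_enlarge.
Qed.

Lemma pts_size_homo xi r r' : r <= r' -> (size (pts x0 xi r) <= size (pts x0 xi r'))%N.
Proof.
move=> rr'; rewrite -(hitsT (pts x0 xi r)) (pts_le sepX xi rr')//.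
exact: hits_leT.
Qed.

Lemma restr_ball_const xi r r' : r <= r' ->
  size (pts x0 xi r) = size (pts x0 xi r') ->
  forall A, measurable A -> restr_ball x0 xi r A = restr_ball x0 xi r' A.
Proof.
move=> rr' sE A mA; rewrite !restr_ballE !(ptsP sepX)//; congr (_%:R%:E).
rewrite (pts_le sepX xi rr')//.
have /hits_eqT H : hits (pts x0 xi r') (B r) = size (pts x0 xi r').
  rewrite -sE -(hitsT (pts x0 xi r)) (pts_le sepX xi rr')//.
  by apply: hits_eq => x _; rewrite setTI.
by apply: hits_eq => x /H Bx; split => [[]|].
Qed.

(** On the radii where both balls have prescribed masses the two restricted measures
    do not depend on the radius. These sets of radii are intervals, there are
    countably many of them, and on each the function is constant. *)
Lemma measurable_distr (h : R -> R) xi zeta :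
  measurable_fun setT (fun r : measurableTypeR R => h (distr xi zeta r)).
Proof.
move=> _ Y _; rewrite setTI.
pose L (ij : nat * nat) := [set r | [/\ size (pts x0 xi r) = ij.1,
  size (pts x0 zeta r) = ij.2 & Y (h (distr xi zeta r))]].
rewrite (_ : _ @^-1` _ = \bigcup_ij L ij); last first.
  apply/seteqP; split => [r Yr|r [_ _ [_ _]]//].
  by exists (size (pts x0 xi r), size (pts x0 zeta r)).
apply: countable_bigcupT_measurable => [|ij]; first exact: countableP.
apply: is_interval_measurable.
move=> r r' [r1 r2 rY] [r'1 r'2 _] u /andP[ru ur'].
(* The mass of a ball is monotone in the radius, hence constant in between. *)
have same (eta : Nsharp X) k : size (pts x0 eta r) = k -> size (pts x0 eta r') = k ->
    size (pts x0 eta u) = k.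
  move=> <- rr'; apply/eqP; rewrite eqn_leq (pts_size_homo _ ru) andbT -rr'.
  exact: pts_size_homo.
have s1 := same _ _ r1 r'1; have s2 := same _ _ r2 r'2.
split => //; rewrite (_ : distr xi zeta u = distr xi zeta r)//.
by apply: prohorov_eq => A mA; apply/esym/restr_ball_const; rewrite // ?s1 ?s2.
Qed.

Lemma distr_ge0 xi zeta r : 0 <= distr xi zeta r.
Proof. exact: prohorov_ge0. Qed.

Lemma weight_ge0 xi zeta r : 0 <= weight xi zeta r.
Proof. by rewrite mulr_ge0 ?expR_ge0// saturate_ge0// distr_ge0. Qed.

Lemma weight_le xi zeta r : weight xi zeta r <= expR (- r).
Proof. by rewrite ler_piMr ?expR_ge0// saturate_le1// distr_ge0. Qed.

Lemma measurable_weight xi zeta : measurable_fun setT (weight xi zeta :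
  measurableTypeR R -> R).
Proof.
apply: measurable_funM; last exact: measurable_distr.
by apply: measurableT_comp; [exact: measurable_expR|exact: oppr_measurable].
Qed.

Lemma measurable_halfline : measurable halfline.
Proof. exact: (@measurable_itv R). Qed.

Lemma integrable_expRN : leb.-integrable halfline (EFin \o (fun r => expR (- r))).
Proof.
have := integrableS measurableT measurable_halfline (@subsetT _ _)
  (@integrable_exponential_pdf R 1 ltr01).
apply: eq_integrable; first exact: measurable_halfline.
move=> r; rewrite inE/= in_itv/= andbT => r0.
by rewrite exponential_pdfE// mul1r mulN1r.
Qed.

Lemma integrable_weight xi zeta : leb.-integrable halfline (EFin \o weight xi zeta).
Proof.
apply: le_integrable integrable_expRN; first exact: measurable_halfline.
  by apply/measurable_EFinP; apply: measurable_funTS; exact: measurable_weight.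
move=> r _ /=; rewrite lee_fin ger0_norm ?weight_ge0// ger0_norm ?expR_ge0//.
exact: weight_le.
Qed.

Lemma dsharp_ge0 xi zeta : 0 <= dsharp x0 xi zeta.
Proof. by apply: Rintegral_ge0 => r _; exact: weight_ge0. Qed.

Lemma dsharpEFin xi zeta :
  (dsharp x0 xi zeta)%:E = (\int[leb]_(r in halfline) (weight xi zeta r)%:E)%E.
Proof.
rewrite dsharpE /Rintegral fineK//.
exact: (integrable_fin_num measurable_halfline (integrable_weight xi zeta)).
Qed.

Lemma dsharpxx xi : dsharp x0 xi xi = 0.
Proof.
rewrite dsharpE (_ : weight xi xi = fun=> 0); last first.
  by apply/funext => r; rewrite /weight /distr prohorovxx /saturate mul0r mulr0.
by rewrite /Rintegral integral0.
Qed.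

Lemma dsharp_sym xi zeta : dsharp x0 xi zeta = dsharp x0 zeta xi.
Proof.
rewrite !dsharpE; congr Rintegral; apply/funext => r.
by rewrite /weight /distr prohorov_sym.
Qed.

Lemma dsharp_triangle zeta xi eta :
  dsharp x0 xi eta <= dsharp x0 xi zeta + dsharp x0 zeta eta.
Proof.
rewrite !dsharpE -RintegralD//; [|exact: integrable_weight..].
apply: le_Rintegral => //; first exact: integrable_weight.
  rewrite (_ : _ \o _ = (EFin \o weight xi zeta) \+ (EFin \o weight zeta eta))%E//.
  by apply: integrableD => //; exact: integrable_weight.
move=> r _; rewrite -mulrDr ler_wpM2l ?expR_ge0//.
apply: le_trans (saturateD (distr_ge0 _ _ _) (distr_ge0 _ _ _)).
by apply: saturate_homo; [exact: distr_ge0|exact: prohorov_triangle].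
Qed.

Definition far xi zeta (T q : R) : set (measurableTypeR R) :=
  `[T, T + 1]%classic `&` [set r | q <= distr xi zeta r].

Lemma measurable_far xi zeta (T q : R) :
  measurable (far xi zeta T q).
Proof.
rewrite /far.
rewrite (_ : [set r | _] = distr xi zeta @^-1` `[q, +oo[); last first.
  by apply/seteqP; split => r; rewrite /= in_itv/= andbT.
apply: measurableI; first exact: (@measurable_itv R).
rewrite -[X in measurable X]setTI.
by apply: (@measurable_distr idfun xi zeta) => //; exact: (@measurable_itv R).
Qed.

Lemma dsharp_markov xi zeta (T q : R) : 0 <= T -> 0 <= q ->
  ((expR (- (T + 1)) * saturate q)%:E *
    leb (far xi zeta T q) <= (dsharp x0 xi zeta)%:E)%E.
Proof.
move=> T0 q0; have mS := measurable_far xi zeta T q.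
rewrite dsharpEFin -integral_cst//.
have mw (D : set (measurableTypeR R)) :
    measurable_fun D (EFin \o weight xi zeta : measurableTypeR R -> \bar R).
  by apply/measurable_EFinP; apply: measurable_funTS; exact: measurable_weight.
apply: (@le_trans _ _ (\int[leb]_(r in far xi zeta T q) (weight xi zeta r)%:E)%E).
  apply: ge0_le_integral => //.
  - by move=> r _ /=; rewrite lee_fin mulr_ge0 ?expR_ge0 ?saturate_ge0.
  - move=> r [/=]; rewrite in_itv/= => /andP[_ rT] /= qr; rewrite lee_fin.
    by rewrite ler_pM ?expR_ge0 ?saturate_ge0 ?ler_expR ?lerN2// saturate_homo.
apply: ge0_subset_integral => //.
- by move=> r _; rewrite lee_fin weight_ge0.
- by move=> r [/=]; rewrite !in_itv/= andbT => /andP[Tr _] _; exact: le_trans Tr.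
Qed.

(** If the restrictions were [q] apart at every radius in [T, T + 1], the integral
    over this interval alone would exceed the bound. *)
Lemma dsharp_close xi zeta (T q : R) : 0 <= T -> 0 < q ->
  dsharp x0 xi zeta < expR (- (T + 1)) * saturate q ->
  exists2 r, T <= r <= T + 1 & distr xi zeta r < q.
Proof.
move=> T0 q0 dq; apply: contrapT => H.
have SE : far xi zeta T q = `[T, T + 1]%classic.
  apply/setIidl => r /= rT; rewrite leNgt; apply/negP => rq.
  by apply: H; exists r => //; move: rT; rewrite in_itv.
have := dsharp_markov xi zeta T0 (ltW q0).
rewrite SE lebesgue_measure_itv/= lte_fin ltrDl ltr01 -EFinD addrAC subrr add0r mule1.
by rewrite lee_fin leNgt dq.
Qed.

(** Dominated convergence, with the exponential as dominating function. *)
Lemma dsharp_cvg0 xi (u : nat -> Nsharp X) :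
  {ae leb, forall r, halfline r -> distr xi (u n) r @[n --> \oo] --> (0 : R)} ->
  dsharp x0 xi (u n) @[n --> \oo] --> (0 : R).
Proof.
move=> H.
have [|||||] := @dominated_convergence _ _ _ leb halfline measurable_halfline
  (fun n => EFin \o weight xi (u n)) (cst 0%E) (EFin \o (fun r => expR (- r))).
- by move=> n; apply/measurable_EFinP; apply: measurable_funTS;
  exact: measurable_weight.
- exact: measurable_cst.
- apply: filterS H => r + r0 => /(_ r0) h; apply/fine_cvgP; split; first exact: nearW.
  apply: (@squeeze_cvgr _ _ _ _ (cst 0) (fun n => distr xi (u n) r)) => //;
    last exact: cvg_cst.
  apply: nearW => n /=; rewrite weight_ge0/=.
  move: r0; rewrite /= in_itv/= andbT => r0.
  apply: le_trans (saturate_le_id (distr_ge0 _ _ _)).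
  by rewrite ler_piMl ?saturate_ge0 ?distr_ge0// -expR0 ler_expR oppr_le0.
- exact: integrable_expRN.
- apply: aeW => r n _ /=; rewrite lee_fin ger0_norm ?weight_ge0//.
  exact: weight_le.
move=> _ _; rewrite integral0 => /fine_cvgP[_].
by [].
Qed.

End dsharp.

(** * Lower semicontinuity and separation of points *)

Section positivity.
Context (R : realType) (X : completeMetricType R) (x0 : X).
Hypothesis sepX : separable X.
Implicit Types (xi zeta : Nsharp X) (A C G : set X).

Local Notation B r := (ball x0 r : set (borelType X)).

(** The masses of the [F k] converge to the mass of the union and are integers: if
    all were below [n], they would be at most [n - 1], and so would the limit. *)
Lemma ext_nat_exhaust xi (F : (set (borelType X))^nat) (n : nat) :
  (forall k, measurable (F k)) -> nondecreasing_seq F ->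
  (n%:R%:E <= xi (\bigcup_k F k))%E -> exists k, (n%:R%:E <= xi (F k))%E.
Proof.
move=> mF ndF; have mU := bigcupT_measurable _ mF.
have Fcvg := nondecreasing_cvg_mu (mu := xi) mF mU ndF.
case: n => [|n] nF; first by exists 0%N; rewrite measure_ge0.
apply: contrapT => /forallNP H; move: nF; apply/negP; rewrite -ltNge.
rewrite (@le_lt_trans _ _ n%:R%:E) ?lte_fin ?ltr_nat//.
rewrite -(cvg_lim _ Fcvg)//; apply: lime_le; first by apply/cvg_ex; eexists;
  exact: Fcvg.
apply: nearW => k /=; rewrite leNgt; apply/negP => nk; apply: (H k).
by apply: ext_nat_gt => //; exact: Nsharp_nat.
Qed.

Lemma ext_nat_le (y z : \bar R) : ext_nat y -> ext_nat z ->
  (forall n : nat, (n%:R%:E <= y)%E -> (n%:R%:E <= z)%E) -> (y <= z)%E.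
Proof.
move=> [->|[n ->]] zN yz; last exact: yz.
case: zN yz => [->//|[n -> /(_ n.+1)]]; rewrite leey => /(_ isT).
by rewrite lee_fin ler_nat ltnn.
Qed.

(** The points of [G] whose distance to the complement of [G] is at least [q]. *)
Definition core G (q : R) : set X := ~` enlarge (~` G) q.

Lemma measurable_core G q : measurable (core G q : set (borelType X)).
Proof. by apply: measurableC; exact: measurable_enlarge. Qed.

Lemma enlarge_core G q : enlarge (core G q) q `<=` G.
Proof.
move=> y /enlargeP[a Ga ay]; apply: contrapT => Gy; apply: Ga.
by apply/enlargeP; exists y => //; rewrite metric_sym.
Qed.

Lemma core_bigcup G : open G -> \bigcup_k (core G k.+1%:R^-1 `&` B k%:R) = G.
Proof.
move=> oG; apply/seteqP; split => [y [k _ [yk _]]|y Gy].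
  by apply: contrapT => Gy; apply: yk; apply: sub_enlarge.
have [d /= d0 dG] : nbhs_ball y G by rewrite nbhs_ballE; exact: open_nbhs_nbhs.
near \oo => k; exists k => //; split.
  move=> /enlargeP[z Gz zy]; apply: Gz; apply: dG; apply/in_ball.
  rewrite metric_sym (lt_trans zy)//.
  by near: k; exact: (near_infty_natSinv_lt (PosNum d0)).
apply/in_ball; near: k; exact: nbhs_infty_gtr.
Unshelve. all: end_near. Qed.

(** By [core_bigcup] some bounded core of [G] already carries [n] points of [xi]. At a
    radius where [zeta] is Prohorov-close to [xi], at least as many points of
    [zeta] lie in the enlargement of that core, which is inside [G]. *)
Lemma dsharp_lsc xi G (n : nat) : open G -> (n%:R%:E <= xi G)%E ->
  exists2 d, 0 < d & forall zeta, dsharp x0 xi zeta < d -> (n%:R%:E <= zeta G)%E.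
Proof.
move=> oG; rewrite -{1}(core_bigcup oG) => /ext_nat_exhaust[k||k].
- by apply: measurableI; [exact: measurable_core|exact: measurable_ball_borel].
- apply/nondecreasing_seqP => k; apply/subsetPset => y [yk ky]; split.
    apply: contra_not yk; apply: enlarge_le.
    by rewrite lef_pV2 ?posrE// ler_nat.
  by apply: le_ball ky; rewrite ler_nat.
have := measurable_core G k.+1%:R^-1; set q : R := k.+1%:R^-1 => mA.
have q0 : 0 < q by rewrite invr_gt0.
rewrite (ptsP sepX)// lee_fin ler_nat => nk.
exists (expR (- (k%:R + 1)) * saturate q).
  by rewrite mulr_gt0 ?expR_gt0// saturate_gt0.
move=> zeta /(dsharp_close sepX (ler0n _ k) q0)[r /andP[kr _] rq].
have mG := measurable_openX oG.
apply: (@le_trans _ _ (zeta (G `&` B r))); last first.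
  by apply: measureIl => //; exact: measurable_ball_borel.
rewrite (ptsP sepX)// lee_fin ler_nat (leq_trans nk)// (pts_le sepX xi kr)//.
apply: (@leq_trans (hits (pts x0 xi r) (core G q))); first by apply: hits_le => x _ [].
have q1 : q <= 1 by rewrite invf_le1// ler1n.
apply: leq_trans (prohorov_hits sepX _ q1 rq) _.
by apply: hits_le => x _; exact: enlarge_core.
Qed.

Lemma measure_ext d (T : measurableType d) (m1 m2 : {measure set T -> \bar R}) :
  m1 = m2 :> (set T -> \bar R) -> m1 = m2.
Proof.
case: m1 m2 => f [[a b] [c]] [g [[a' b'] [c']]] /= fg; subst g.
have E1 := Prop_irrelevance a' a; subst a'.
have E2 := Prop_irrelevance b' b; subst b'.
by have E3 := Prop_irrelevance c' c; subst c'.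
Qed.

Lemma Nsharp_eq xi zeta :
  (forall A : set (borelType X), measurable A -> xi A = zeta A) -> xi = zeta.
Proof.
move=> H; have {}H : xi = zeta :> (set (borelType X) -> \bar R).
  apply/funext => A; have [/H//|nmA] := pselect (measurable (A : set (borelType X))).
  by rewrite !Nsharp_junk.
case: xi zeta H => mu mu1 mu2 mu3 [nu nu1 nu2 nu3] /= munu.
have {}munu := measure_ext munu.
by subst nu; congr MkNsharp; exact: Prop_irrelevance.
Qed.

(** By lower semicontinuity in both directions the two measures agree on open sets,
    which are stable under intersection and generate the Borel sets. *)
Lemma dsharp_eq0 xi zeta : dsharp x0 xi zeta = 0 -> xi = zeta.
Proof.
move=> d0; apply: Nsharp_eq.
have le G (xi1 xi2 : Nsharp X) : open G -> dsharp x0 xi1 xi2 = 0 -> (xi1 G <= xi2 G)%E.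
  move=> oG d0'; have mG := measurable_openX oG.
  apply: ext_nat_le => [||n nG]; [exact: Nsharp_nat..|].
  by have [d dgt0 dP] := dsharp_lsc oG nG; apply: dP; rewrite d0'.
apply: (@measure_unique _ R (borelType X) (@open X) (fun k => B k%:R)) => //.
- by move=> ? ?; exact: openI.
- by move=> k; exact: open_ballX.
- apply/seteqP; split => // x _; near \oo => k; exists k => //; apply/in_ball.
  by near: k; exact: nbhs_infty_gtr.
- by move=> G oG; apply/eqP; rewrite eq_le !le// dsharp_sym.
- by move=> k; exact: Nsharp_ball_lty.
Unshelve. all: end_near. Qed.

Lemma dsharp_is_metric : is_metric (@dsharp R X x0).
Proof.
split.
- exact: dsharpxx.
- exact: dsharp_eq0.
- exact: dsharp_sym.
- exact: dsharp_triangle.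
Qed.

End positivity.

(** * A countable network of sets defined by masses *)

Section neighbourhoods.
Context (R : realType) (X : completeMetricType R) (x0 : X).
Hypothesis sepX : separable X.
Implicit Types (xi zeta : Nsharp X) (A C G : set X) (s : seq X).

Local Notation B r := (ball x0 r : set (borelType X)).

(** Closeness in the large ball of radius [T] passes to the ball of radius [r] as
    soon as no point of [s] lies so near the sphere of radius [r] that a
    displacement smaller than [q] could carry it across. For the second
    inequality the hypothesis is applied to the complement of
    [enlarge A q `&` ball x0 (r + q)], using that the total masses agree. *)
Lemma distr_le_restrict xi zeta s (r T q : R) : 0 < q -> r <= T ->
  (forall A, measurable (A : set (borelType X)) ->
    hits (pts x0 xi r) A = hits s (A `&` B r)) ->
  size s = size (pts x0 zeta T) ->
  (forall A, (hits s A <= hits (pts x0 zeta T) (enlarge A q))%N) ->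
  (forall x, x \in s -> ~ (r - q <= mdist x0 x < r + q)) ->
  distr x0 xi zeta r <= q.
Proof.
move=> q0 rT xis sz szeta shell; apply: prohorov_le_hits => //; first exact: ltW.
- move=> A cA; have mA := measurable_closedX cA.
  have mAq := measurable_enlarge A q.
  rewrite xis// (pts_le sepX zeta rT)//.
  apply: (@leq_trans (hits s (A `&` [set x | mdist x0 x < r - q]))).
    apply: hits_le => x /shell xs [Ax /in_ball xr]; split => //=.
    by rewrite ltNge; apply/negP => rx; apply: xs; rewrite rx/= (lt_trans xr)// ltrDl.
  apply: leq_trans (szeta _) _; apply: hits_le => y _ /enlargeP[a [Aa /= ar] ay].
  split; first by apply/enlargeP; exists a.
  apply/in_ball; apply: le_lt_trans (metric_triangle _ a _) _.
  by rewrite -[ltRHS](subrK q) ltrD.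
- move=> A cA; have mA := measurable_closedX cA.
  have mAq := measurable_enlarge A q.
  rewrite xis// (pts_le sepX zeta rT)//.
  set D := enlarge A q `&` B (r + q).
  apply: (@leq_trans (hits s D)); last first.
    apply: hits_le => x /shell xs [Ax /in_ball xr]; split => //; apply/in_ball.
    rewrite ltNge; apply/negP => rx; apply: xs; rewrite xr andbT (le_trans _ rx)//.
    by rewrite gerBl ltW.
  rewrite -(leq_add2r (hits s (~` D))) hitsC sz.
  rewrite -(hitsC (pts x0 zeta T) (A `&` B r)) leq_add2l.
  apply: leq_trans (szeta _) _; apply: hits_le =>
    y _ /enlargeP[c Dc cy] [Ay /in_ball yr].
  apply: Dc; split; first by apply/enlargeP; exists y => //; rewrite metric_sym.
  apply/in_ball; apply: le_lt_trans (metric_triangle _ y _) _.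
  by rewrite ltrD// metric_sym.
Qed.

Lemma pts_mem xi r x : (x \in pts x0 xi r) = (0 < xi [set x])%E && (mdist x0 x < r).
Proof.
have [xr|xr] := boolP (mdist x0 x < r); rewrite (andbT, andbF); last first.
  by apply/negP => /pts_ball - /(_ sepX); apply/negP.
have mx := measurable_set1X x.
rewrite (_ : xi [set x] = xi ([set x] `&` B r)); last first.
  by congr (xi _); apply/esym/setIidl => _ ->; apply/in_ball.
rewrite (ptsP sepX)// lte_fin ltr0n -has_count.
by apply/idP/hasP => [xs|[y ys]]; [exists x; rewrite ?inE|rewrite inE => <-].
Qed.

(** A condition that becomes easier as [q] decreases can be met uniformly along a
    finite list. *)
Lemma list_eps s (P : X -> R -> Prop) :
  (forall x q q', P x q -> 0 < q' <= q -> P x q') ->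
  (forall x, x \in s -> exists2 q, 0 < q & P x q) ->
  exists2 q, 0 < q & forall x, x \in s -> P x q.
Proof.
move=> Pdec; elim: s => [|x s IH] Ps; first by exists 1.
have [q q0 qP] := Ps x (mem_head _ _).
have [|q' q'0 q'P] := IH; first by move=> y ys; apply: Ps; rewrite inE ys orbT.
have m0 : 0 < Num.min q q' by rewrite lt_min q0.
exists (Num.min q q') => // y; rewrite inE => /orP[/eqP ->|ys].
  by apply: Pdec qP _; rewrite m0 ge_min lexx.
by apply: Pdec (q'P y ys) _; rewrite m0 ge_min lexx orbT.
Qed.

(** The radii of the spheres around [x0] that carry an atom of [xi]: the only ones at
    which restriction to the ball of that radius may fail to be continuous at
    [xi]. *)
Definition radii xi : set R := \bigcup_n [set mdist x0 x | x in [set` pts x0 xi n%:R]].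

Lemma countable_radii xi : countable (radii xi).
Proof.
apply: bigcup_countable; first exact: countableP.
by move=> n _; apply: finite_set_countable; apply: finite_image; exact: finite_seq.
Qed.

Lemma negligible_radii xi :
  (@lebesgue_measure R).-negligible (radii xi : set (measurableTypeR R)).
Proof.
apply/negligibleP; last exact/countable_lebesgue_measure0/countable_radii.
by apply: countable_measurable; [exact: measurable_set1|exact: countable_radii].
Qed.

Lemma radiiP xi x : (0 < xi [set x])%E -> radii xi (mdist x0 x).
Proof.
move=> x0'; near \oo => n; exists n => //; exists x => //=.
rewrite pts_mem x0'/=; near: n; exact: nbhs_infty_gtr.
Unshelve. all: end_near. Qed.

Lemma empty_shell xi r : ~ radii xi r -> exists2 q, 0 < q &
  forall x, (0 < xi [set x])%E -> ~ (r - q <= mdist x0 x < r + q).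
Proof.
move=> nr.
have [|x|q q0 qP] := @list_eps (pts x0 xi (r + 1))
  (fun x q => ~ (r - q <= mdist x0 x < r + q)).
- move=> x q q' H /andP[q'0 q'q]; apply: contra_not H => /andP[h1 h2]; apply/andP;
  split.
    by apply: le_trans h1; rewrite lerB.
  by rewrite (lt_le_trans h2)// lerD2l.
- rewrite pts_mem => /andP[/radiiP xr _].
  (* Half of the distance, because the shell contains its inner sphere. *)
  exists (`|r - mdist x0 x| / 2).
    by rewrite divr_gt0// normr_gt0 subr_eq0; apply/eqP => rx; apply: nr; rewrite rx.
  move=> /andP[].
  have : r - mdist x0 x != 0.
    by rewrite subr_eq0; apply/eqP => rx; apply: nr; rewrite rx.
  by rewrite neq_lt; case: (ger0P (r - mdist x0 x)) => ? /orP[] ? ? ?; lra.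
(* A shell of width at most 1 stays inside the ball whose atoms were listed. *)
exists (Num.min q 1); first by rewrite lt_min q0 ltr01.
move=> x x0' /andP[h1 h2]; apply: (qP x).
  by rewrite pts_mem x0'/= (lt_le_trans h2)// lerD2l ge_min lexx orbT.
apply/andP; split.
  by apply: le_trans h1; rewrite lerB// ge_min lexx.
by rewrite (lt_le_trans h2)// lerD2l ge_min lexx.
Qed.

Variable e : nat -> X.

(** The list [map e c] stands for approximate positions of the atoms in the ball of
    radius [n]. The requirement that every sublist [c'] be matched by enough mass
    near its points is the condition of Hall's theorem; it involves the masses of
    finitely many Borel sets. *)
Definition box (c : seq nat) (n : nat) : set (Nsharp X) := [set zeta : Nsharp X |
  zeta (B n%:R) = (size c)%:R%:E /\
  forall c', subseq c' c -> ((size c')%:R%:E <=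
    zeta ((enlarge [set e k | k in [set` c']] n.+1%:R^-1 :
      set (borelType X)) `&` B n%:R))%E].

Hypothesis edense : forall x r, 0 < r -> exists k, mdist (e k) x < r.

Lemma ex_code (n : nat) : exists f : X -> nat, forall x, mdist (e (f x)) x < n.+1%:R^-1.
Proof.
have H x : {k | mdist (e k) x < n.+1%:R^-1} by apply/cid/edense; rewrite invr_gt0.
by exists (fun x => sval (H x)) => x; case: (H x).
Qed.

Lemma box_self xi n f : (forall x, mdist (e (f x)) x < n.+1%:R^-1) ->
  box (map f (pts x0 xi n%:R)) n xi.
Proof.
move=> fP; split; first by rewrite size_map pts_size.
move=> c' /subseqP[m sm ->]; rewrite -map_mask size_map (ptsP sepX)//;
  last exact: measurable_enlarge.
rewrite lee_fin ler_nat.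
apply: (@leq_trans (hits (mask m (pts x0 xi n%:R))
    (enlarge [set e k | k in [set` map f (mask m (pts x0 xi n%:R))]] n.+1%:R^-1)));
      last first.
  by apply: leq_count_subseq; exact: mask_subseq.
rewrite -hitsT; apply: hits_le => x xm _; apply/enlargeP; exists (e (f x)) => //.
by exists (f x) => //=; exact: map_f.
Qed.

Lemma box_hits xi zeta n f : (forall x, mdist (e (f x)) x < n.+1%:R^-1) ->
  box (map f (pts x0 xi n%:R)) n zeta ->
  size (pts x0 xi n%:R) = size (pts x0 zeta n%:R) /\
  forall A, (hits (pts x0 xi n%:R) A <=
    hits (pts x0 zeta n%:R) (enlarge A (2 * n.+1%:R^-1)))%N.
Proof.
move=> fP [zs zP]; split.
  by move: zs; rewrite size_map (pts_size x0 sepX) => -[/eqP]; rewrite eqr_nat => /eqP.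
move=> A; have := zP _ (map_subseq f (filter_subseq
  (fun x => x \in A) (pts x0 xi n%:R))).
rewrite size_map size_filter (ptsP sepX); last exact: measurable_enlarge.
rewrite lee_fin ler_nat => /leq_trans; apply; apply: hits_le => y _.
move=> /enlargeP[_ [_ /= /mapP[x + ->] <-]] xy;
  rewrite mem_filter => /andP[/set_mem Ax _].
apply/enlargeP; exists x => //; apply: le_lt_trans (metric_triangle _ (e (f x)) _) _.
by rewrite mulr_natl mulr2n ltrD// metric_sym.
Qed.

(** Take boxes around [xi] with [n] growing, coded by points of the dense sequence
    near the atoms of [xi]. If each contained a measure at distance at least
    [eps] from [xi], these measures would converge to [xi] by [box_hits],
    [distr_le_restrict] and dominated convergence. *)
Lemma box_basis xi (eps : R) : 0 < eps ->
  exists c n, box c n xi /\ forall zeta, box c n zeta -> dsharp x0 xi zeta < eps.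
Proof.
move=> eps0; apply: contrapT => H.
have Hn n : exists zeta, eps <= dsharp x0 xi zeta /\
    (size (pts x0 xi n%:R) = size (pts x0 zeta n%:R) /\
  forall A, (hits (pts x0 xi n%:R) A <=
    hits (pts x0 zeta n%:R) (enlarge A (2 * n.+1%:R^-1)))%N).
  have [f fP] := ex_code n; apply: contrapT => H'; apply: H.
  exists (map f (pts x0 xi n%:R)), n; split; first exact: box_self.
  move=> zeta zbox; rewrite ltNge; apply/negP => ez; apply: H'; exists zeta;
    split => //.
  exact: box_hits zbox.
pose u n := sval (cid (Hn n)).
have uP n : _ := svalP (cid (Hn n)).
have : dsharp x0 xi (u n) @[n --> \oo] --> (0 : R).
  apply: (dsharp_cvg0 sepX).
  apply: (negligibleS _ (negligible_radii xi)) => r /= nr; apply: contrapT => nrad;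
    apply: nr => _.
  have [d d0 dP] := empty_shell nrad; have d20 : 0 < d / 2 by rewrite divr_gt0.
  apply/cvgrPdist_le => /= ep ep0; have ep20 : 0 < ep / 2 by rewrite divr_gt0.
  near=> n; rewrite sub0r normrN ger0_norm ?distr_ge0//.
  apply: (@le_trans _ _ (2 * n.+1%:R^-1)); last first.
    rewrite mulrC -ler_pdivlMr// ltW//.
    by near: n; exact: (near_infty_natSinv_lt (PosNum ep20)).
  have [_ [sz hz]] := uP n; apply: distr_le_restrict sz hz _ => //.
  - near: n; exact: nbhs_infty_ger.
  - move=> A mA; apply: (pts_le sepX) => //; near: n; exact: nbhs_infty_ger.
  - move=> x; rewrite pts_mem => /andP[/dP xsh _] /andP[h1 h2]; apply: xsh.
    have nd : 2 * n.+1%:R^-1 <= d.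
      rewrite mulrC -ler_pdivlMr// ltW//.
      by near: n; exact: (near_infty_natSinv_lt (PosNum d20)).
    by move: nd h1 h2; move: (2 * _) => q ? ? ?; apply/andP; split; lra.
move=> /cvgrPdist_lt /(_ _ eps0)[N _ /(_ N (leqnn _))].
have [eN _] := uP N.
by rewrite sub0r normrN ger0_norm ?dsharp_ge0// ltNge eN.
Unshelve. all: end_near. Qed.

End neighbourhoods.

(** * The Borel sets of the space of measures *)

Section counting_maps.
Context (R : realType) (X : completeMetricType R).

Lemma mzero_lty (A : set (borelType X)) : measurable A -> mbounded A ->
  ((@mzero _ (borelType X) R) A < +oo)%E.
Proof. by move=> _ _; exact: ltry. Qed.

Lemma mzero_nat (A : set (borelType X)) : measurable A ->
  ext_nat ((@mzero _ (borelType X) R) A).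
Proof. by move=> _; right; exists 0%N. Qed.

Lemma mzero_junk (A : set (borelType X)) : ~ measurable A ->
  (@mzero _ (borelType X) R) A = 0%E.
Proof. by []. Qed.

Definition Nsharp0 : Nsharp X := MkNsharp mzero_lty mzero_nat mzero_junk.

(* Generated sigma-algebras form a measurable space over pointed types only. *)
HB.instance Definition _ := gen_eqMixin (Nsharp X).
HB.instance Definition _ := gen_choiceMixin (Nsharp X).
HB.instance Definition _ := isPointed.Build (Nsharp X) Nsharp0.

Lemma countable_ext_nat : countable (@ext_nat R).
Proof.
apply: (@sub_countable _ _ _ [set: option nat]) (countableP _).
apply: card_le_trans (card_image_le (fun o =>
  if o is Some n then n%:R%:E else +oo%E) _).
by apply: subset_card_le => y [->|[n ->]]; [exists None|exists (Some n)].
Qed.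

Lemma Phi_setI (A : set (borelType X)) S : measurable A ->
  Phi A @^-1` S = Phi A @^-1` (S `&` @ext_nat R) :> set (Nsharp X).
Proof.
move=> mA; apply/seteqP; split => [xi Sxi|xi []//].
by split => //; exact: Nsharp_nat.
Qed.

End counting_maps.

Section borel_structure.
Context (R : realType) (X : completeMetricType R) (x0 : X).
Hypothesis sepX : separable X.
Hypothesis H : is_metric (@dsharp R X x0).
Implicit Types (xi zeta : Nsharp X) (A C G : set (borelType X)).

Local Notation B r := (ball x0 r : set (borelType X)).
Local Notation MS := (metric_space H).
Local Notation opens := (@open MS : set (set (Nsharp X))).

Lemma open_dsharpP (U : set (Nsharp X)) : opens U <->
  forall xi, U xi -> exists2 eps, 0 < eps & forall zeta, dsharp x0 xi zeta < eps ->
    U zeta.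
Proof.
split=> [oU xi Uxi|UP].
  have : nbhs (xi : MS) U by exact: open_nbhs_nbhs.
  by rewrite -nbhs_ballE => -[eps /= eps0 epsU]; exists eps => // zeta ?; exact: epsU.
rewrite openE => xi /UP[eps eps0 epsU]; rewrite /interior -nbhs_ballE.
by exists eps => //= zeta; exact: epsU.
Qed.

Lemma open_Phi_ge G (n : nat) : open (G : set X) ->
  opens [set xi | (n%:R%:E <= Phi G xi)%E].
Proof.
by move=> oG; apply/open_dsharpP => xi nxi; exact: dsharp_lsc.
Qed.

Local Notation MT := (g_sigma_algebraType opens).

(** The set where the mass of [G] exceeds [r] is open: it is the union, over the
    integers [n > r], of the open sets where this mass is at least [n]. *)
Lemma measurable_Phi_open G : open (G : set X) ->
  measurable_fun setT (Phi G : MT -> \bar R).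
Proof.
move=> oG; apply: (measurability _ (ErealGenOInfty.measurableE R)) => //.
move=> _ [_ [r ->] <-].
rewrite setTI; apply: sub_sigma_algebra.
have -> : Phi G @^-1` `]r%:E, +oo[%classic =
    \bigcup_(n in [set n : nat | r < n%:R])
      [set xi : Nsharp X | (n%:R%:E <= Phi G xi)%E].
  apply/seteqP; split => xi /=; rewrite in_itv/= andbT.
    have [nE|[n nE]] := Nsharp_nat xi (measurable_openX oG); rewrite /Phi nE.
      move=> _; near \oo => n; exists n; last by rewrite /= nE leey.
      by near: n; exact: nbhs_infty_gtr.
    by rewrite lte_fin => rn; exists n => //=; rewrite nE.
  by move=> [n /= rn]; apply: lt_le_trans; rewrite lte_fin.
by apply: bigcup_open => n _; exact: open_Phi_ge.
Unshelve. all: end_near. Qed.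

(** Dynkin's induction from open sets, inside a fixed ball so that the masses are
    finite and complements turn into differences; then the radius tends to
    infinity. *)
Lemma measurable_Phi A : measurable A -> measurable_fun setT (Phi A : MT -> \bar R).
Proof.
move=> mA.
have mB k := measurable_ball_borel x0 (k%:R : R).
have ball_part k : measurable_fun setT (Phi (A `&` B k%:R) : MT -> \bar R).
  pose P (C : set (borelType X)) :=
    measurable_fun setT (Phi (C `&` B k%:R) : MT -> \bar R).
  suff: P A by [].
  apply: (@dynkin_induction _ (borelType X) (@open X) P) => //.
  - by move=> ? ?; exact: openI.
  - by rewrite /P setTI; apply: measurable_Phi_open; exact: open_ballX.
  - by move=> C oC; apply: measurable_Phi_open; apply: openI => //; exact: open_ballX.
  - move=> C mC PC; rewrite /P.
    rewrite (_ : Phi _ = fun xi => (Phi (B k%:R) xi - Phi (C `&` B k%:R) xi)%E).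
      by apply: emeasurable_funB PC; exact: measurable_Phi_open (@open_ballX _ _ _ _).
    apply/funext => xi; rewrite /Phi setIC -setDE measureD//;
      last exact: Nsharp_ball_lty.
    by rewrite setIC.
  - move=> F mF tF PF; rewrite /P.
    rewrite (_ : Phi _ = fun xi =>
      (\sum_(0 <= n <oo | n \in predT) Phi (F n `&` B k%:R) xi)%E).
      by apply: ge0_emeasurable_sum => [n xi _ _|n _]; [exact: measure_ge0|exact: PF].
    apply/funext => xi; rewrite /Phi setI_bigcupl measure_bigcup//=.
    + by apply: eq_eseriesl => n; rewrite in_setT.
    + by move=> n _; apply: measurableI.
    + by apply: trivIset_setIr.
apply: (@emeasurable_fun_cvg _ MT _ setT (fun k => Phi (A `&` B k%:R))) => // xi _.
have mAB k : measurable (A `&` B k%:R) by exact: measurableI.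
have := nondecreasing_cvg_mu (mu := xi) mAB (bigcupT_measurable _ mAB).
have -> : \bigcup_k (A `&` B k%:R) = A.
  apply/seteqP; split => [x [k _ []//]|x Ax]; near \oo => k; exists k => //;
    split => //.
  by apply/in_ball; near: k; exact: nbhs_infty_gtr.
apply; apply/nondecreasing_seqP => k; apply/subsetPset => x [Ax kx]; split => //.
by apply: le_ball kx; rewrite ler_nat.
Unshelve. all: end_near. Qed.

Lemma borel_makes_Phi_measurable :
  makes_Phi_measurable (<<s opens >> : set_system (Nsharp X)).
Proof.
move=> A mA S SN; have mS : measurable S.
  apply: countable_measurable; first exact: emeasurable_set1.
  exact: sub_countable (subset_card_le SN) (countable_ext_nat R).
by have := measurable_Phi mA measurableT mS; rewrite setTI.
Qed.

Variable e : nat -> X.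
Hypothesis edense : forall x r, 0 < r -> exists k, mdist (e k) x < r.

Lemma box_in_sigma_algebra (F : set_system (Nsharp X)) c n :
  sigma_algebra setT F -> makes_Phi_measurable F -> F (box x0 e c n).
Proof.
move=> sF PF; have FE := sigma_algebra_id sF.
have mPhi A S : measurable A ->
    measurable (Phi A @^-1` S : set (g_sigma_algebraType F)).
  by move=> mA; rewrite Phi_setI// /measurable /= FE; apply: PF => // ? [].
suff : measurable (box x0 e c n : set (g_sigma_algebraType F)).
  by rewrite /measurable /= FE.
pose E (c' : seq nat) : set (borelType X) :=
  enlarge [set e k | k in [set` c']] n.+1%:R^-1 `&` B n%:R.
have -> : box x0 e c n = Phi (B n%:R) @^-1` [set (size c)%:R%:E] `&`
    ~` (\bigcup_(c' : seq nat) (if subseq c' c then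
       ~` (Phi (E c') @^-1` [set y | ((size c')%:R%:E <= y)%E]) else set0)).
  apply/seteqP; split => [zeta [z1 z2]|zeta [z1 z2]]; split => //.
    by move=> [c' _]; case: ifP => // /z2 + H'; exact.
  by move=> c' cc; apply: contrapT => H'; apply: z2; exists c' => //; rewrite cc.
apply: measurableI; first by apply: mPhi; exact: measurable_ball_borel.
apply: measurableC; apply: countable_bigcupT_measurable => [|c'];
  first exact: countableP.
case: ifP => // _; apply: measurableC; apply: mPhi.
by apply: measurableI; [exact: measurable_enlarge|exact: measurable_ball_borel].
Qed.

(** An open set is the union of the boxes that it contains, and there are only
    countably many boxes. *)
Lemma borel_minimal (F : set_system (Nsharp X)) :
  sigma_algebra setT F -> makes_Phi_measurable F -> <<s opens >> `<=` F.
Proof.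
move=> sF PF; apply: smallest_sub => // U oU; have FE := sigma_algebra_id sF.
suff : measurable (U : set (g_sigma_algebraType F)) by rewrite /measurable /= FE.
have -> : U = \bigcup_(cn : seq nat * nat)
    (if `[< box x0 e cn.1 cn.2 `<=` U >] then box x0 e cn.1 cn.2 else set0).
  apply/seteqP; split => [xi Uxi|xi [cn _]]; last by case: asboolP => // h /h.
  have /open_dsharpP/(_ _ Uxi)[eps eps0 epsU] := oU.
  have [c [n [xibox boxeps]]] := box_basis x0 sepX edense xi eps0.
  by exists (c, n) => //=; case: asboolP => // -[] zeta /boxeps/epsU.
apply: countable_bigcupT_measurable => [|cn]; first exact: countableP.
case: ifP => // _; have := @box_in_sigma_algebra F cn.1 cn.2 sF PF.
by rewrite /measurable /= FE.
Qed.

Lemma separable_metric_space : separable MS.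
Proof.
exists [set xget (Nsharp0 X) (box x0 e cn.1 cn.2) | cn in [set: seq nat * nat]].
  exact: sub_countable (card_image_le _ _) (countableP _).
move=> U [xi Uxi] oU.
have /open_dsharpP/(_ _ Uxi)[eps eps0 epsU] : opens U by [].
have [c [n [xibox boxeps]]] := box_basis x0 sepX edense xi eps0.
exists (xget (Nsharp0 X) (box x0 e c n)); split; last by exists (c, n).
by apply/epsU/boxeps; exact: xgetI xibox.
Qed.

End borel_structure.

(** * Hall's marriage theorem *)

Section marriage.
(* Sets are finite sets in this section: the names of their lemmas take
   precedence over those of classical sets. *)
Import boot.fintype boot.finset.
Local Close Scope classical_set_scope.
Local Open Scope nat_scope.
Variables (I J : finType).
Implicit Types (N : I -> {set J}) (S : {set I}).

Definition hall N := forall S, #|S| <= #|\bigcup_(i in S) N i|.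

Definition prune N i j : I -> {set J} := fun k => if k == i then N i :\ j else N k.

Lemma bigcup_pruneD1 N i j S : \bigcup_(k in S :\ i) prune N i j k =
  \bigcup_(k in S :\ i) N k.
Proof.
by apply: eq_bigr => k; rewrite !inE /prune => /andP[/negPf ->].
Qed.

(** If deleting [j1] destroyed the condition at some [S1], and deleting [j2] at some
    [S2], both sets would contain [i]; submodularity of the number of neighbours,
    applied to [S1] and [S2] without [i], contradicts the condition for [N]. *)
Lemma hall_prune N i j1 j2 : hall N -> j1 \in N i -> j2 \in N i -> j1 != j2 ->
  hall (prune N i j1) \/ hall (prune N i j2).
Proof.
move=> hN j1N j2N j12.
have [/forallP h|/forallPn[S1]] :=
  boolP [forall S : {set I}, #|S| <= #|\bigcup_(k in S) prune N i j1 k|]; first by left.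
have [/forallP h _|/forallPn[S2]] :=
  boolP [forall S : {set I}, #|S| <= #|\bigcup_(k in S) prune N i j2 k|];
    first by right.
have viol j (S : {set I}) : ~~ (#|S| <= #|\bigcup_(k in S) prune N i j k|) ->
    #|(N i :\ j) :|: \bigcup_(k in S :\ i) N k| <= #|S :\ i|.
  rewrite -ltnNge => lt; have [iS|iS] := boolP (i \in S).
    move: lt; rewrite (big_setD1 i)//= bigcup_pruneD1 {1}/prune eqxx => lt.
    by rewrite -ltnS (leq_trans lt)// (cardsD1 i S) iS.
  have SE : S :\ i = S.
    by apply/setP => k; rewrite !inE; case: eqP => // ->; rewrite (negPf iS).
  have NE : \bigcup_(k in S) prune N i j k = \bigcup_(k in S) N k.
    by rewrite -SE bigcup_pruneD1.
  by move: lt; rewrite NE ltnNge hN.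
move=> /viol v2 /viol v1.
set A1 := S1 :\ i in v1; set A2 := S2 :\ i in v2.
set W1 := _ :|: _ in v1; set W2 := _ :|: _ in v2.
have iA : i \notin A1 :|: A2 by rewrite !inE eqxx.
have hU : #|A1 :|: A2|.+1 <= #|W1 :|: W2|.
  have -> : #|A1 :|: A2|.+1 = #|i |: (A1 :|: A2)| by rewrite cardsU1 iA.
  apply: leq_trans (hN _) (subset_leq_card _); apply/bigcupsP => k.
  rewrite in_setU1 in_setU => /orP[/eqP ->|/orP[kA|kA]].
  - apply/subsetP => j jN; rewrite /W1 /W2 !inE jN !andbT.
    by have [->|//] := eqVneq j j1; rewrite j12 orbT.
  - rewrite -setUA (subset_trans _ (subsetUr _ _))// (subset_trans _ (subsetUl _ _))//.
    exact: bigcup_sup.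
  - rewrite [W2]setUC setUA setUAC (subset_trans _ (subsetUr _ _))//.
    exact: bigcup_sup.
have hI : #|A1 :&: A2| <= #|W1 :&: W2|.
  apply: leq_trans (hN _) (subset_leq_card _); apply/bigcupsP => k.
  rewrite in_setI => /andP[k1 k2]; rewrite subsetI; apply/andP; split.
    by rewrite (subset_trans _ (subsetUr _ _))//; exact: bigcup_sup.
  by rewrite (subset_trans _ (subsetUr _ _))//; exact: bigcup_sup.
have := leq_add hU hI; rewrite addSn !cardsUI => h.
by have := leq_trans h (leq_add v1 v2); rewrite ltnn.
Qed.

(** Prune neighbours as long as some [i] has two of them. When each has one left, the
    condition on singletons and pairs says that this defines an injection. *)
Theorem hall_marriage N : hall N ->
  exists2 f : I -> J, injective f & forall i, f i \in N i.
Proof.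
have [n] := ubnP (\sum_i #|N i|); elim: n N => // n IH N Nn hN.
have [/existsP[i iN]|/existsPn N1] := boolP [exists i, 1 < #|N i|].
  have /card_gt1P[j1 [j2 [j1N j2N j12]]] := iN.
  have step j : j \in N i -> hall (prune N i j) ->
      exists2 f : I -> J, injective f & forall i, f i \in N i.
    move=> jN hP; have [|f finj fP] := IH _ _ hP.
      apply: leq_trans _ (Nn : _ <= n).
      rewrite (bigD1 i)//= [X in _ < X](bigD1 i)//= {1}/prune eqxx (cardsD1 j (N i)) jN.
      rewrite add1n addSn ltnS leq_add2l leq_sum// => k /negPf ki.
      by rewrite /prune ki.
    exists f => // k; have := fP k; rewrite /prune; case: eqP => // ->.
    by rewrite inE => /andP[].
  by have [] := hall_prune hN j1N j2N j12; exact: step.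
have N1' i : exists j, N i == [set j].
  suff /cards1P[j ->] : #|N i| == 1 by exists j.
  by rewrite eqn_leq leqNgt N1/=; have := hN [set i]; rewrite big_set1 cards1.
have [f N1E] : exists f : I -> J, forall i, N i = [set f i].
  by exists (fun i => xchoose (N1' i)) => i; exact/eqP/(xchooseP (N1' i)).
exists f => [i i'|i]; last by rewrite N1E inE.
move=> fii'; apply/eqP; apply/negPn/negP => ii'.
have := hN [set i; i']; rewrite cards2 ii' bigcup_setU !big_set1.
by rewrite (N1E i) (N1E i') fii' setUid cards1.
Qed.

End marriage.

(** * Limits of sequences of configurations *)

Section limit_configuration.
Context (R : realType) (X : completeMetricType R).
Implicit Types (s t : seq X) (A : set X) (e q : R).

Lemma hits_map (I : finType) (x : I -> X) A :
  hits [seq x i | i <- enum I] A = #|[set i | x i \in A]%SET|.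
Proof. by rewrite /hits count_map cardsE cardE size_filter enumT. Qed.

Lemma size_map_enum (I : finType) (x : I -> X) : size [seq x i | i <- enum I] = #|I|.
Proof. by rewrite size_map -cardE. Qed.

(** For lists of equal length the counting inequality is symmetric: apply it to the
    complement of [enlarge A e]. *)
Lemma hits_dual s t e : size s = size t ->
  (forall A, (hits s A <= hits t (enlarge A e))%N) ->
  forall A, (hits t A <= hits s (enlarge A e))%N.
Proof.
move=> sz st A; rewrite -(leq_add2r (hits s (~` enlarge A e))) hitsC sz.
rewrite -(hitsC t A) leq_add2l; apply: leq_trans (st _) _.
apply: hits_le => y _ /enlargeP[c Ac cy] Ay; apply: Ac.
by apply/enlargeP; exists y => //; rewrite metric_sym.
Qed.

Lemma matching (I : finType) (x y : I -> X) e :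
  (forall A, (hits [seq x i | i <- enum I] A <=
    hits [seq y i | i <- enum I] (enlarge A e))%N) ->
  exists2 f : I -> I, injective f & forall i, mdist (x i) (y (f i)) < e.
Proof.
move=> xy; pose N i := [set j | mdist (x i) (y j) < e]%SET.
have [|f finj fP] := @hall_marriage I I N; last first.
  by exists f => // i; have := fP i; rewrite inE.
move=> S; pose A : set X := [set x i | i in [set` S]].
have := xy A; rewrite !hits_map => h.
apply: leq_trans (leq_trans _ h) _; apply: subset_leq_card; apply/fintype.subsetP => i.
  by move=> iS; rewrite inE; apply/mem_set; exists i.
rewrite inE => /set_mem/enlargeP[_ [k /= kS <-] ki].
by apply/bigcupP; exists k => //; rewrite inE.
Qed.

Lemma fast_cauchy_cvg (z : nat -> X) : (forall n, mdist (z n) (z n.+1) < 2 ^- n) ->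
  exists y, forall n, mdist (z n) y <= 2 * 2 ^- n.
Proof.
move=> zP.
have zz n k : mdist (z n) (z (n + k)%N) <= 2 * 2 ^- n - 2 * 2 ^- (n + k).
  elim: k => [|k IH]; first by rewrite addn0 mdistxx subrr.
  rewrite addnS; apply: le_trans (metric_triangle _ (z (n + k)%N) _) _.
  by have := zP (n + k)%N; have := halfS R (n + k)%N; lra.
have small (eps : R) : 0 < eps -> \forall n \near \oo, 2 * 2 ^- n < eps.
  move=> eps0; have eps20 : 0 < eps / 2 by rewrite divr_gt0.
  apply: filterS (near_infty_natSinv_expn_lt (PosNum eps20)) => n /=.
  by rewrite div1r; lra.
have /cvg_ex[y /metricType_numDomainType.cvgrPdist_lt yP] : cvg (z @ \oo).
  apply: cauchy_cvg; apply: cauchy_exP => eps eps0.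
  have [N _ /(_ N (leqnn _)) NP] := small _ eps0.
  exists (z N); exists N => // m /= Nm; apply/in_ball.
  rewrite -(subnKC Nm); apply: le_lt_trans (zz _ _) _.
  by have := half_gt0 R (N + (m - N))%N; lra.
exists y => n; apply/ler_addgt0Pl => eps eps0.
have [N _ NP] := yP _ eps0.
have := zz n N; have := half_gt0 R (n + N)%N; have := NP (n + N)%N (leq_addl _ _).
have := metric_triangle (z n) (z (n + N)%N) y; rewrite (metric_sym y).
move: (mdist _ _) (mdist _ _) (mdist _ _) => a b c; lra.
Qed.

(** By the marriage theorem the points of [s n] and [s n.+1] can be matched with
    displacements smaller than [2 ^- n]. Following the matchings gives [N] Cauchy
    sequences of points, and [t] lists their limits. *)
Lemma limit_configuration (N : nat) (s : nat -> seq X) :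
  (forall n, size (s n) = N) ->
  (forall n A, (hits (s n) A <= hits (s n.+1) (enlarge A (2 ^- n)))%N) ->
  exists2 t, size t = N &
    forall n A, (hits t A <= hits (s n) (enlarge A (4 * 2 ^- n)))%N.
Proof.
move=> sN sP.
pose x n (i : 'I_N) := nth point (s n) i.
have sE n : [seq x n i | i <- enum 'I_N] = s n.
  rewrite /x (map_comp (nth point (s n)) val) val_enum_ord -(sN n).
  exact: mkseq_nth.
have step n : {f : 'I_N -> 'I_N | injective f /\
    forall i, mdist (x n i) (x n.+1 (f i)) < 2 ^- n}.
  by apply/cid; have [|f] := @matching _ (x n) (x n.+1) (2 ^- n);
    [rewrite !sE|exists f].
(* [sigma n i] is the position in [s n] of the point that starts at position [i]
   of [s 0]. *)
pose sigma := fix sigma n : 'I_N -> 'I_N :=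
  if n is n'.+1 then sval (step n') \o sigma n' else id.
have sinj n : injective (sigma n).
  elim: n => [|n IH]; first by [].
  by apply: inj_comp => //; case: (step n) => f [].
have z_ i : {y | forall n, mdist (x n (sigma n i)) y <= 2 * 2 ^- n}.
  apply/cid; apply: (@fast_cauchy_cvg (fun n => x n (sigma n i))) => n /=.
  by case: (step n) => f [_ /=]; exact.
exists [seq sval (z_ i) | i <- enum 'I_N]; first by rewrite size_map_enum card_ord.
move=> n A; rewrite -[s n]sE !hits_map.
rewrite -(card_imset _ (sinj n)); apply: subset_leq_card; apply/fintype.subsetP => j.
move=> /imsetP[i]; rewrite inE => /set_mem Ay ->; rewrite inE; apply/mem_set/enlargeP.
exists (sval (z_ i)) => //; case: (z_ i) => y /= yP.
rewrite metric_sym; apply: le_lt_trans (yP n) _.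
by rewrite ltr_pM2r ?half_gt0// ltr_nat.
Qed.

End limit_configuration.

(** * Gluing configurations into a measure *)

Section configuration_measures.
Context (R : realType) (X : completeMetricType R).
Implicit Types (s t : seq X) (A : set (borelType X)) (e q : R).

(** The partial sums are integers, so they are either unbounded or eventually
    constant. *)
Lemma ext_nat_series (a : nat -> nat) : @ext_nat R (\sum_(k <oo) (a k)%:R%:E)%E.
Proof.
pose p k := (\sum_(i < k) a i)%N.
have pE k : (\sum_(0 <= i < k) (a i)%:R%:E = (p k)%:R%:E :> \bar R)%E.
  by rewrite big_mkord sumEFin -natr_sum.
have ge_p k : ((p k)%:R%:E <= \sum_(k <oo) (a k)%:R%:E :> \bar R)%E.
  by rewrite -pE; apply: nneseries_lim_ge => n _; rewrite lee_fin.
have [[m mP]|unb] := pselect (exists m, forall k, (p k <= m)%N).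
  have ex : exists m, `[< forall k, (p k <= m)%N >] by exists m; apply/asboolP.
  case: (ex_minnP ex) => {mP}m /asboolP mP mmin.
  right; exists m; apply/eqP; rewrite eq_le; apply/andP; split.
    apply: lime_le; first by apply: is_cvg_nneseries => n _ _; rewrite lee_fin.
    by apply: nearW => k; rewrite pE lee_fin ler_nat.
  have [[k pk]|H] := pselect (exists k, p k = m); first by rewrite -pk.
  case: m mP mmin H => [|m] mP mmin H; first by rewrite nneseries_ge0// => n _ _;
    rewrite lee_fin.
  have /mmin : `[< forall k, (p k <= m)%N >].
    apply/asboolP => k; rewrite -ltnS ltn_neqAle mP andbT; apply/eqP => pk.
    by apply: H; exists k.
  by rewrite ltnn.
left; apply/eqyP => r r0.
have [k rk] : exists k, r <= (p k)%:R.
  apply: contrapT => /forallNP H; apply: unb; exists (Num.truncn r).+1 => k.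
  have /negP := H k; rewrite -ltNge => pr.
  by rewrite ltnW// -(ltr_nat R) (lt_trans pr)// truncnS_gt.
by apply: le_trans (ge_p k); rewrite lee_fin.
Qed.

Definition conf_measure s : {measure set (borelType X) -> \bar R} :=
  msum (fun i => \d_(nth point s i : borelType X)) (size s).

Lemma conf_measureE s A : conf_measure s A = (hits s A)%:R%:E.
Proof.
transitivity (\sum_(i < size s) (nth point s i \in A)%:R%:E : \bar R)%E.
  by apply: eq_bigr => i _; rewrite -indicE.
rewrite sumEFin -natr_sum /hits -sum1_count (big_nth point) big_mkord.
by congr (_%:R%:E); rewrite [RHS]big_mkcond; apply: eq_bigr => i _; case: ifP.
Qed.

Section cutoff.
Variable m : {measure set (borelType X) -> \bar R}.

Definition cutoff A : \bar R := if `[< measurable A >] then m A else 0%E.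

Lemma cutoffE A : measurable A -> cutoff A = m A.
Proof. by move=> mA; rewrite /cutoff asboolT. Qed.

Let cutoff0 : cutoff set0 = 0%E.
Proof. by rewrite cutoffE// measure0. Qed.

Let cutoff_ge0 A : (0 <= cutoff A)%E.
Proof. by rewrite /cutoff; case: ifP => // _; exact: measure_ge0. Qed.

Let cutoff_sigma : semi_sigma_additive cutoff.
Proof.
move=> F mF tF mUF; rewrite cutoffE//.
rewrite (_ : (fun n => _) = (fun n => \sum_(0 <= i < n) m (F i))%E).
  exact: measure_semi_sigma_additive.
by apply/funext => n; apply: eq_bigr => i _; rewrite cutoffE.
Qed.

HB.instance Definition _ := isMeasure.Build _ _ _ cutoff cutoff0 cutoff_ge0
  cutoff_sigma.

(** [Nsharp] prescribes the value 0 off the Borel sets; cutting a measure off there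
    keeps it a measure. *)
Lemma Nsharp_of_measure :
  (forall A, measurable A -> mbounded (A : set X) -> (m A < +oo)%E) ->
  (forall A, measurable A -> ext_nat (m A)) ->
  exists xi : Nsharp X, forall A, measurable A -> xi A = m A.
Proof.
move=> mb mn.
have cb A : measurable A -> mbounded (A : set X) -> (cutoff A < +oo)%E.
  by move=> mA; rewrite cutoffE//; exact: mb.
have cn A : measurable A -> ext_nat (cutoff A).
  by move=> mA; rewrite cutoffE//; exact: mn.
have cj A : ~ measurable A -> cutoff A = 0%E.
  by move=> mA; rewrite /cutoff asboolF.
by exists (MkNsharp cb cn cj) => A mA; exact: cutoffE.
Qed.

End cutoff.

(** Cut the space into the annuli between consecutive integer radii, keep in the
    annulus between [i] and [i + 1] the points of the list [S i.+1], and add up the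
    counting measures of these finite pieces. *)
Lemma glue (x0 : X) (S : nat -> seq X) :
  (forall j k A, (j <= k)%N -> A `<=` ball x0 j%:R -> hits (S j) A = hits (S k) A) ->
  exists xi : Nsharp X, forall j A, measurable A -> A `<=` ball x0 j%:R ->
    xi A = (hits (S j) A)%:R%:E.
Proof.
move=> Scons.
pose B k : set (borelType X) := ball x0 (k%:R : R).
have mB k : measurable (B k) by exact: measurable_ball_borel.
pose L i := [seq x <- S i.+1 | x \in B i.+1 `\` B i].
have LE i A : hits (L i) A = hits (S i.+1) (A `&` (B i.+1 `\` B i)) by exact:
  hits_filter.
pose m : {measure set (borelType X) -> \bar R} :=
  mseries (fun i => conf_measure (L i)) 0.
have mE A : m A = (\sum_(i <oo) (hits (L i) A)%:R%:E)%E.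
  by rewrite /m /= /mseries; apply: eq_eseriesr => i _; rewrite conf_measureE.
have Bmono i j : (i <= j)%N -> B i `<=` B j by move=> ij; apply: le_ball;
  rewrite ler_nat.
have sumL j A : A `<=` B j -> (\sum_(i < j) hits (L i) A)%N = hits (S j) A.
  move=> AB.
  have partial k : (k <= j)%N -> (\sum_(i < k) hits (L i) A)%N = hits (S j) (A `&` B k).
    elim: k => [_|k IH kj].
      rewrite big_ord0; apply/esym/eqP; rewrite -leqn0 leqNgt -has_count.
      apply/hasPn => x _; apply/negP => /set_mem[_ /in_ball].
      by rewrite ltNge mdist_ge0.
    rewrite big_ord_recr/= IH ?(ltnW kj)// LE (Scons _ _ _ kj); last by move=> x [_ []].
    rewrite [RHS](hits_setID _ _ (B k)) -setIA (setIidr (Bmono _ _ (leqnSn k))).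
    by rewrite setIDA.
  by rewrite partial// (setIidl AB).
have mfin j A : A `<=` B j -> m A = (hits (S j) A)%:R%:E.
  move=> AB; rewrite mE (nneseries_split 0 j)// add0n.
  rewrite [X in (_ + X)%E]eseries0; last first.
    move=> i ji _; rewrite LE (@hits_eq _ _ _ set0) ?hits0// => x _;
      split => // -[Ax [_]].
    by apply; exact: (Bmono _ _ ji _ (AB _ Ax)).
  by rewrite adde0 big_mkord sumEFin -natr_sum sumL.
have [||xi xiE] := @Nsharp_of_measure m.
- move=> A mA [x [r Axr]].
  near \oo => j.
  apply: (@le_lt_trans _ _ (m (B j))); last by rewrite (mfin j)// ltry.
  apply: le_measure; rewrite ?inE// => y /Axr /in_ball xy; apply/in_ball.
  apply: le_lt_trans (metric_triangle _ x _) _.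
  apply: (@lt_trans _ _ (mdist x0 x + r)); first by rewrite ltrD2l.
  by near: j; exact: nbhs_infty_gtr.
- by move=> A mA; rewrite mE; exact: ext_nat_series.
by exists xi => j A mA AB; rewrite xiE// (mfin j).
Unshelve. all: end_near. Qed.

End configuration_measures.

(** * Completeness *)

Section completeness.
Context (R : realType) (X : completeMetricType R) (x0 : X).
Hypothesis sepX : separable X.
Implicit Types (mu : nat -> Nsharp X) (S : seq X) (A : set X) (r q T : R).

Local Notation B r := (ball x0 r : set (borelType X)).

(** Convergence of the restrictions to the ball of radius [r], as configurations. The
    limit [S] may have points on the sphere of radius [r], outside the open ball;
    this is why [S] is a list and not the restriction of a limit measure. *)
Definition conv_at mu r S := forall q, 0 < q -> \forall n \near \oo,
  size S = size (pts x0 (mu n) r) /\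
  forall A, (hits S A <= hits (pts x0 (mu n) r) (enlarge A q))%N.

(** For small [q], the points of [mu n] that are [q]-close to the points of [S] in [A]
    lie in both balls, hence are seen at both radii, and can be close to points of
    [S'] in [A] only. Exchanging the roles of the radii gives equality. *)
Lemma conv_at_le mu r r' S S' A : conv_at mu r S -> conv_at mu r' S' ->
  A `<=` B r -> A `<=` B r' -> (hits S A <= hits S' A)%N.
Proof.
move=> cS cS' Ar Ar'.
have [|x xS|q q0 qP] := @list_eps _ _ S (fun x q => A x ->
    [/\ mdist x0 x + q <= r, mdist x0 x + q <= r' &
      forall y, y \in S' -> ~ A y -> 2 * q <= mdist x y]).
- move=> x q q' + /andP[q'0 q'q] Ax => /(_ Ax)[h1 h2 h3].
  split; [exact: le_trans (lerD (lexx _) q'q) h1|exact: le_trans (lerD (lexx _) q'q)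
    h2|].
  by move=> y yS' Ay; apply: le_trans (h3 y yS' Ay); rewrite ler_pM2l.
- have [Ax|nAx] := pselect (A x); last by exists 1.
  have [|y yS'|q q0 qP] := @list_eps _ _ S' (fun y q => ~ A y -> 2 * q <= mdist x y).
  + by move=> y q q' h /andP[_ q'q] /h; apply: le_trans; rewrite ler_pM2l.
  + exists (if mdist x y == 0 then 1 else mdist x y / 2).
      by case: eqVneq => // xy; rewrite divr_gt0// lt_neqAle eq_sym xy mdist_ge0.
    move=> nAy; case: eqVneq => [/mdist_positivity xy|_]; first by case: nAy;
      rewrite -xy.
    by rewrite mulrC divfK.
  have /in_ball xr := Ar _ Ax; have /in_ball xr' := Ar' _ Ax.
  exists (Num.min q (Num.min (r - mdist x0 x) (r' - mdist x0 x))).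
    by rewrite !lt_min q0 !subr_gt0 xr.
  move=> _; split.
  + by rewrite -lerBrDl !ge_min lexx orbT.
  + by rewrite -lerBrDl !ge_min lexx !orbT.
  + by move=> y yS' nAy; apply: le_trans (qP y yS' nAy); rewrite ler_pM2l// ge_min lexx.
near \oo => n.
have [sz h] : size S = size (pts x0 (mu n) r) /\
  forall A, (hits S A <= hits (pts x0 (mu n) r) (enlarge A q))%N by near: n; exact: cS.
have [sz' h'] : size S' = size (pts x0 (mu n) r') /\
  forall A, (hits S' A <= hits (pts x0 (mu n) r') (enlarge A q))%N by near: n;
    exact: cS'.
pose F := [set x | x \in S /\ A x].
have mF := measurable_enlarge F q.
have Fsub : enlarge F q `<=` B r /\ enlarge F q `<=` B r'.
  by split=> y /enlargeP[x [xS Ax] xy]; have [xr xr' _] := qP x xS Ax; apply/in_ball;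
    [apply: lt_le_trans xr|apply: lt_le_trans xr'];
    apply: le_lt_trans (metric_triangle _ x _) _; rewrite ltrD2l.
apply: (@leq_trans (hits S F)); first by apply: hits_le => x xS Ax.
apply: leq_trans (h F) _.
have -> : hits (pts x0 (mu n) r) (enlarge F q) = hits (pts x0 (mu n) r') (enlarge F q).
  apply/eqP; rewrite -(eqr_nat R) -eqe -!(ptsP sepX)//.
  by rewrite (setIidl Fsub.1) (setIidl Fsub.2).
apply: leq_trans (hits_dual sz' h' _) _; apply: hits_le => y yS'.
move=> /enlarge_enlarge/enlargeP[x [xS Ax] xy]; apply: contrapT => nAy.
by have [_ _ /(_ y yS' nAy)] := qP x xS Ax; rewrite leNgt mulr_natl mulr2n xy.
Unshelve. all: end_near. Qed.

(** One factor [2 ^- n.+1] pays for the threshold [2 ^- n] in the Markov inequality,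
    the other makes the resulting measures summable. *)
Definition fast mu := forall n, dsharp x0 (mu n) (mu n.+1) <= 2 ^- n.+1 * 2 ^- n.+1.

(** By the Markov inequality the sets of radii in [T, T + 1] where [mu n] and
    [mu n.+1] are at least [2 ^- n] apart have summable measures. By Borel-Cantelli
    almost every radius lies in finitely many of them only, and the interval has
    measure 1. *)
Lemma fast_radius mu T : fast mu -> 0 <= T -> exists2 r, T <= r <= T + 1 &
  \forall n \near \oo, distr x0 (mu n) (mu n.+1) r < 2 ^- n.
Proof.
move=> mufast T0.
pose F n := far x0 (mu n) (mu n.+1) T (2 ^- n).
have mF n : measurable (F n) by exact: measurable_far.
have d0 := half_gt0 R; have d1 := half_le1 R.
have leF n : (lebesgue_measure (F n) <= (expR (T + 1) / (2 ^ n.+1)%:R)%:E)%E.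
  have := dsharp_markov x0 sepX (mu n) (mu n.+1) T0 (ltW (d0 n)).
  rewrite -/(F n) => h.
  have c0 : 0 < expR (- (T + 1)) * 2 ^- n.+1 by rewrite mulr_gt0 ?expR_gt0.
  have {h} : ((expR (- (T + 1)) * 2 ^- n.+1)%:E * lebesgue_measure (F n) <=
      (2 ^- n.+1 * 2 ^- n.+1)%:E)%E.
    apply: le_trans (le_trans h _); last by rewrite lee_fin.
    apply: lee_wpmul2r => //; rewrite lee_fin ler_wpM2l ?expR_ge0//.
    rewrite exprS invfM mulrC /saturate ler_pM2l// lef_pV2 ?posrE ?addr_gt0//.
    by rewrite lerD2l.
  rewrite -lee_pdivlMl// -EFinM => /le_trans; apply; rewrite lee_fin.
  rewrite natrX expRN; move: (d0 n.+1) (expR_gt0 (T + 1)).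
  move: (expR _) (2 ^+ n.+1) => a b; rewrite invr_gt0 => b0 a0.
  by rewrite le_eqVlt; apply/orP; left; apply/eqP; field; rewrite !gt_eqF.
have lim0 : lebesgue_measure (lim_sup_set F) = 0%E.
  apply: lim_sup_set_cvg0 => //; apply: (@le_lt_trans _ _ (expR (T + 1))%:E);
    last by rewrite ltry.
  apply: le_trans (epsilon_trick0 xpredT (expR_ge0 _)).
  by apply: lee_nneseries => [n _ _|n _]; [exact: measure_ge0|exact: leF].
apply: contrapT => H.
pose I : set (measurableTypeR R) := `[T, T + 1]%classic.
have : (lebesgue_measure I <= lebesgue_measure (lim_sup_set F))%E.
  apply: le_measure; rewrite ?inE.
  - exact: (@measurable_itv R).
  - apply: bigcapT_measurable => k; exact: bigcup_measurable.
  - move=> r /= rT n _; apply: contrapT => Hn; apply: H; exists r; first by move: rT;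
    rewrite /I /= in_itv.
    exists n => // m /= nm; rewrite ltNge; apply/negP => far_m.
    by apply: Hn; exists m => //; split.
by rewrite lim0 /I lebesgue_measure_itv/= lte_fin ltrDl ltr01 -EFinD addrAC subrr
  add0r lee_fin ler10.
Qed.

(** From some index on the distances are below 1, so the lists have equal length and
    [limit_configuration] applies to the shifted sequence. *)
Lemma fast_conv_at mu T : fast mu -> 0 <= T ->
  exists rS : R * seq X, T <= rS.1 /\ conv_at mu rS.1 rS.2.
Proof.
move=> mufast T0; have [r /andP[Tr _] [n0 _ n0P]] := fast_radius mufast T0.
have d1 := half_le1 R.
pose s n := pts x0 (mu (n + n0)%N) r.
have sP n A : (hits (s n) A <= hits (s n.+1) (enlarge A (2 ^- n)))%N.
  have h : distr x0 (mu (n + n0)%N) (mu (n + n0).+1) r < 2 ^- (n + n0) by apply: n0P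
    => /=; rewrite leq_addl.
  apply: leq_trans (prohorov_hits sepX A (d1 _) h) _; apply: hits_le => x _;
    apply: enlarge_le.
  by rewrite lef_pV2 ?posrE ?exprn_gt0// ler_eXn2l ?ltr1n// leq_addr.
have sP' n A : (hits (s n.+1) A <= hits (s n) (enlarge A (2 ^- (n + n0))))%N.
  have h : distr x0 (mu (n + n0)%N) (mu (n + n0).+1) r < 2 ^- (n + n0) by apply: n0P
    => /=; rewrite leq_addl.
  by move: h; rewrite /distr prohorov_sym => /(prohorov_hits sepX A (d1 _)).
have sz n : size (s n) = size (s 0%N).
  elim: n => // n <-; apply/eqP; rewrite eqn_leq; apply/andP; split.
    by rewrite -(hitsT (s n.+1)) (leq_trans (sP' n _))// hits_leT.
  by rewrite -(hitsT (s n)) (leq_trans (sP n _))// hits_leT.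
have [S SN SP] := limit_configuration sz sP.
exists (r, S); split => //= q q0.
have q40 : 0 < q / 4 by rewrite divr_gt0.
have [n1 _ n1P] := near_infty_natSinv_expn_lt (PosNum q40).
exists (n1 + n0)%N => // n /= nn; rewrite -(subnK (leq_trans (leq_addl _ _) nn)).
have := SP (n - n0)%N; have := sz (n - n0)%N; rewrite -/(s _) SN => -> h; split => // A.
apply: leq_trans (h A) _; apply: hits_le => x _; apply: enlarge_le.
have := n1P (n - n0)%N; rewrite /= leq_subRL ?(leq_trans (leq_addl _ _) nn)//
  addnC nn => /(_ isT).
by rewrite div1r; lra.
Qed.

(** Glue the limit lists found at radii [r j >= j]. At a radius [t] that carries no
    atom of the result, [distr_le_restrict] brings the convergence at a larger
    radius [r j] down to [t]; almost every [t] is of this kind. *)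
Lemma fast_cvg mu : fast mu -> exists xi, dsharp x0 xi (mu n) @[n --> \oo] --> (0 : R).
Proof.
move=> mufast.
have rS j : {rS : R * seq X | j%:R <= rS.1 /\ conv_at mu rS.1 rS.2}.
  exact/cid/fast_conv_at.
pose r j := (sval (rS j)).1; pose S j := (sval (rS j)).2.
have rj j : j%:R <= r j by case: (svalP (rS j)).
have cS j : conv_at mu (r j) (S j) by case: (svalP (rS j)).
have Bj j k : (j <= k)%N -> B j%:R `<=` B (r k).
  by move=> jk; apply: le_ball; apply: le_trans (rj k); rewrite ler_nat.
have [|xi xiP] := @glue _ _ x0 S.
  move=> j k A jk Aj; have Aj' := subset_trans Aj (Bj j j (leqnn _)).
  have Ak' := subset_trans Aj (Bj j k jk).
  by apply/eqP; rewrite eqn_leq !(conv_at_le (cS _) (cS _)).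
exists xi; apply: (dsharp_cvg0 sepX).
apply: (negligibleS _ (negligible_radii x0 xi)) => t /= nt; apply: contrapT => nrad;
  apply: nt => _.
have [d d0 dP] := empty_shell sepX nrad.
near \oo => j.
have tj : t + 1 <= j%:R by near: j; exact: nbhs_infty_ger.
have tj' : t <= j%:R by apply: le_trans tj; rewrite lerDl.
apply/cvgrPdist_le => /= ep ep0.
pose q := Num.min ep (Num.min d 1).
have q0 : 0 < q by rewrite !lt_min ep0 d0 ltr01.
apply: filterS (cS j q q0) => n [sz h]; rewrite sub0r normrN ger0_norm ?distr_ge0//.
apply: (@le_trans _ _ q); last by rewrite ge_min lexx.
apply: (distr_le_restrict sepX q0 (le_trans tj' (rj j)) _ sz h).
  move=> A mA; apply/eqP; rewrite -(eqr_nat R) -eqe -(ptsP sepX)// (xiP j)//.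
    by apply: measurableI => //; exact: measurable_ball_borel.
  by move=> y [_]; exact: le_ball.
move=> x xS /andP[h1 h2]; apply: (dP x).
  rewrite (xiP j); [|exact: measurable_set1X|].
    by rewrite lte_fin ltr0n -has_count; apply/hasP; exists x => //; rewrite inE.
  move=> _ ->; apply/in_ball; apply: lt_le_trans h2 _; apply: le_trans tj.
  by rewrite lerD2l !ge_min lexx !orbT.
apply/andP; split; first by apply: le_trans h1; rewrite lerB// !ge_min lexx orbT.
by apply: lt_le_trans h2 _; rewrite lerD2l !ge_min lexx orbT.
Unshelve. all: end_near. Qed.

(** A Cauchy filter is followed by a fast Cauchy sequence of centres of small balls
    belonging to the filter. *)
Lemma complete_dsharp (H : is_metric (@dsharp R X x0)) :
  complete_space (metric_space H).
Proof.
move=> F PF /cauchyP Fex.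
pose d n : R := 2 ^- n.+1 * 2 ^- n.+1 / 2.
have d0 n : 0 < d n by rewrite divr_gt0// mulr_gt0// half_gt0.
pose mu n : Nsharp X := sval (cid (Fex (d n) (d0 n))).
have muP n : F [set zeta : metric_space H | dsharp x0 (mu n) zeta < d n].
  by rewrite /mu; case: cid.
have mufast : fast mu.
  move=> n; have [zeta [z1 z2]] := @filter_ex _ F PF _ (@filterI _ F _ _ _ (muP n)
    (muP n.+1)).
  apply: le_trans (dsharp_triangle x0 sepX zeta _ _) _.
  rewrite (dsharp_sym x0 zeta); move: z1 z2; rewrite /= /d.
  have := halfS R n.+1; have := half_gt0 R n.+1.
  move: (2 ^- n.+1) (2 ^- n.+2) (dsharp _ _ _) (dsharp _ _ _) => a b u v a0 -> h1 h2.
  nra.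
have [xi xiP] := fast_cvg mufast.
exists xi => U; rewrite -nbhs_ballE => -[ep /= ep0 epU].
have ep20 : 0 < ep / 2 by rewrite divr_gt0.
near \oo => n.
have dn : d n < ep / 2.
  near: n; apply: filterS (near_infty_natSinv_expn_lt (PosNum ep20)) => n /=.
  apply: le_lt_trans; rewrite div1r /d halfS.
  have := half_le1 R n; have := half_gt0 R n.
  by move: (2 ^- n) => a; nra.
have xin : dsharp x0 xi (mu n) < ep / 2.
  near: n; move/cvgrPdist_lt : xiP => /(_ _ ep20); apply: filterS => n.
  by rewrite sub0r normrN ger0_norm// dsharp_ge0.
apply: filterS (muP n) => zeta /= nz; apply: epU.
have : dsharp x0 xi zeta < ep.
  apply: le_lt_trans (dsharp_triangle x0 sepX (mu n) _ _) _.
  by rewrite (splitr ep) ltrD// (lt_trans nz).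
by [].
Unshelve. all: end_near. Qed.

End completeness.

(** * The space of boundedly finite integer-valued measures *)

Theorem theorem1p2 (R : realType) (X : completeMetricType R)
    (sepX : separable X) (x0 : X) :
  exists H : is_metric (@dsharp R X x0),
    (complete_space (metric_space H) /\ separable (metric_space H)) /\
    let B : set_system (Nsharp X) := <<s @open (metric_space H) >> in
    [/\ sigma_algebra setT B,
        makes_Phi_measurable B &
        forall F : set_system (Nsharp X),
          sigma_algebra setT F -> makes_Phi_measurable F -> B `<=` F].
Proof.
have [e edense] := separable_seq sepX.
have H := dsharp_is_metric x0 sepX.
exists H; split; first split.
- exact: complete_dsharp.
- exact: (separable_metric_space sepX H edense).
split.
- exact: smallest_sigma_algebra.
- exact: borel_makes_Phi_measurable.
- by move=> F; exact: (borel_minimal sepX edense).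
Qed.
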